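(* Let $\sigma\in C([0,\infty);\mathbb{R})$ and let $f\in C(\mathbb{R};\mathbb{R})$ satisfy $xf(x)>0$ for all $x\ne0$, $f(0)=0$, $\lim_{x\to-\infty}f(x)=-\infty$ and $\lim_{x\to\infty}f(x)=\infty$. Let $X$ be any continuous adapted process which obeys $$dX(t)=-f(X(t))\,dt+\sigma(t)\,dB(t),\quad t\ge0;\qquad X(0)=\xi\in\mathbb{R}.$$ Let $S'(\epsilon)$, $\Omega_1$, $\Omega_X$, $\underline{Y}$, $\overline{Y}$, $\underline{x}(f,\cdot)$ and $\overline{x}(f,\cdot)$ be as defined in the context. (A) If $S'(\epsilon)<+\infty$ for all $\epsilon>0$, then $\lim_{t\to\infty}X(t)=0$ a.s. (B) If there exists $\epsilon'>0$ such that $S'(\epsilon)<+\infty$ for all $\epsilon>\epsilon'$ and $S'(\epsilon)=+\infty$ for all $\epsilon<\epsilon'$, then there exists an almost sure event $\Omega_2=\Omega_1\cap\Omega_X$, and deterministic $0<\underline{X}\le\overline{X}<+\infty$ such that $$\underline{X}=\inf_{\omega\in\Omega_2}\ \limsup_{t\to\infty}|X(t,\omega)|,\qquad \overline{X}=\sup_{\omega\in\Omega_2}\ \limsup_{t\to\infty}|X(t,\omega)|.$$ Moreover $\underline{X}\ge\underline{x}(f,\underline{Y})$ and $\overline{X}\le\overline{x}(f,\overline{Y})$. Furthermore $\liminf_{t\to\infty}|X(t)|=0$ a.s. (C) If $S'(\epsilon)=+\infty$ for all $\epsilon>0$, then $\limsup_{t\to\infty}|X(t)|=+\infty$ and $\liminf_{t\to\infty}|X(t)|=0$,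 a.s.
   Context: $(\Omega,\mathcal{F},(\mathcal{F}(t))_{t\ge0},\mathbb{P})$ is a complete filtered probability space and $B$ a standard one-dimensional Brownian motion adapted to the filtration. The equation for $X$ means $X(t)=\xi-\int_0^tf(X(s))\,ds+\int_0^t\sigma(s)\,dB(s)$ for all $t\ge0$, a.s. (uniqueness is not assumed); $\Omega_X$ is the almost sure event on which the realisation $X(\cdot,\omega)$ obeys this equation. Define $\theta(n)\ge0$ by $\theta^2(n)=\int_n^{n+1}\sigma^2(s)\,ds$ and, for $\epsilon>0$, $S'(\epsilon)=\sum_{n=0}^\infty\theta(n)\exp\left(-\frac{\epsilon^2}{2}\frac1{\theta^2(n)}\right)$, the summand being $0$ if $\theta(n)=0$. $Y$ is the unique continuous adapted solution of $dY(t)=-Y(t)\,dt+\sigma(t)\,dB(t)$, $t\ge0$, $Y(0)=0$; $\Omega_Y$ is the almost sure event on which the realisation $Y(\cdot,\omega)$ obeys this equation; $\Omega_1=\{\omega\in\Omega_Y:0<\limsup_{t\to\infty}|Y(t,\omega)|<+\infty\}$. The deterministic numbers $\underline{Y}$ and $\overline{Y}$ are the pointwise infimum and supremum $\underline{Y}=\inf_{\omega\in\Omega_1}\limsup_{t\to\infty}|Y(t,\omega)|$ and $\overline{Y}=\sup_{\omega\in\Omega_1}\limsup_{t\to\infty}|Y(t,\omega)|$; in case (B), $\Omega_1$ is almost sure and $0<\underline{Y}\le\overline{Y}<+\infty$. For $y\ge0$, $\underline{x}=\underline{x}(f,y)\ge0$ is the unique solution of $2\underline{x}+\max_{|x|\le\underline{x}}|f(x)|=y$.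 Define $f^+(x)=\sup\{z>0:f(z)=x\}$ for $x\ge0$ and $f^-(x)=\inf\{z<0:f(z)=x\}$ for $x\le0$, with $f^+(0)=f^-(0)=0$, and $\overline{x}(f,y)=2y+\max(f^+(y),-f^-(-y))$ for $y\ge0$. *)

(* Defs.v *)
(* MathComp / MathComp-Analysis *)
From HB Require Import structures.
From mathcomp Require Import all_boot all_order all_algebra.
From mathcomp Require Import all_classical all_reals all_analysis.
Set Implicit Arguments.
Unset Strict Implicit.
Unset Printing Implicit Defensive.
Import Order.TTheory GRing.Theory Num.Theory.
Import numFieldNormedType.Exports.
Local Open Scope classical_set_scope.
Local Open Scope ring_scope.

(* Processes are functions [X : R -> T -> R] (time, then outcome), and a
   filtration is a family [F : R -> set (set T)]; in both cases only times
   [t >= 0] are meaningful. *)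

Section processes.
Context d (T : measurableType d) (R : realType) (P : probability T R).

(* [F 0] contains the P-null sets, and the measure P itself is complete. *)
Definition complete_filtration (F : R -> set (set T)) : Prop :=
  [/\ measure_is_complete P,
      (forall t : R, 0 <= t -> sigma_algebra setT (F t)),
      (forall t : R, 0 <= t -> F t `<=` measurable),
      (forall s t : R, 0 <= s -> s <= t -> F s `<=` F t) &
      (forall N, P.-negligible N -> F 0 N)].

Definition adapted (F : R -> set (set T)) (X : R -> T -> R) : Prop :=
  forall t : R, 0 <= t -> forall A : set R, measurable A -> F t (X t @^-1` A).

Definition continuous_process (X : R -> T -> R) : Prop :=
  forall w, {within `[0, +oo[%classic, continuous (fun t => X t w)}.

(* The second parameter of [normal_prob] is the standard deviation. *)
Definition brownian_motion (B : R -> T -> R) : Prop :=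
  [/\ {ae P, forall w, B 0 w = 0},
      {ae P, forall w, {within `[0, +oo[%classic, continuous (fun t => B t w)}},
      (forall s t : R, 0 <= s -> s < t -> forall A : set R, measurable A ->
         P [set w | A (B t w - B s w)] = normal_prob 0 (Num.sqrt (t - s)) A) &
      (forall (n : nat) (t : nat -> R) (A : nat -> set R),
         0 <= t 0%N -> (forall i, t i <= t i.+1) ->
         (forall i, measurable (A i)) ->
         P (\bigcap_(i < n) [set w | A i (B (t i.+1) w - B (t i) w)]) =
         (\prod_(i < n) P [set w | A i (B (t i.+1) w - B (t i) w)%R])%E)].

(* An entry [(c, (a, b))] of an elementary integrand stands for
   c * 1_{]a, b]}. *)
Definition elementary := seq (R * (R * R)).

Definition elementary_in (t : R) (h : elementary) : bool :=
  all (fun p => [&& 0 <= p.2.1, p.2.1 <= p.2.2 & p.2.2 <= t]) h.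

Definition elementary_fun (h : elementary) (x : R) : R :=
  \sum_(p <- h) p.1 * (p.2.1 < x <= p.2.2)%R%:R.

Definition elementary_integral (B : R -> T -> R) (h : elementary) (w : T) : R :=
  \sum_(p <- h) p.1 * (B p.2.2 w - B p.2.1 w).

(* [I] is a continuous adapted version of t |-> \int_0^t sigma(s) dB(s), for a
   deterministic integrand: I(t) is the L^2(P)-limit of the integrals of any
   elementary integrands that converge to sigma in L^2([0, t]). *)
Definition is_stochastic_integral (F : R -> set (set T)) (sigma : R -> R)
    (B I : R -> T -> R) : Prop :=
  [/\ adapted F I, continuous_process I &
      forall t : R, 0 <= t -> forall h : nat -> elementary,
        (forall n, elementary_in t (h n)) ->
        (fun n => \int[lebesgue_measure]_(x in `[0%R, t])
                    ((elementary_fun (h n) x - sigma x) ^+ 2)%R%:E)%E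
          @ \oo --> (0 : \bar R)%E ->
        (fun n => \int[P]_w
                    ((elementary_integral B (h n) w - I t w) ^+ 2)%R%:E)%E
          @ \oo --> (0 : \bar R)%E].

(* The event on which the realisation of X obeys
   X(t) = xi - \int_0^t g(X(s)) ds + I(t) for all t >= 0. *)
Definition solution_event (g : R -> R) (xi : R) (I X : R -> T -> R) : set T :=
  [set w | forall t : R, 0 <= t ->
     X t w = xi - \int[lebesgue_measure]_(s in `[0, t]) g (X s w) + I t w].

Definition is_solution (F : R -> set (set T)) (g : R -> R) (xi : R)
    (I X : R -> T -> R) : Prop :=
  [/\ adapted F X, continuous_process X &
      {ae P, forall w, solution_event g xi I X w}].

Definition almost_sure_event (A : set T) : Prop := measurable A /\ P A = 1%E.

Definition limsup_abs (X : R -> T -> R) (w : T) : \bar R :=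
  limf_esup (fun t => `|X t w|%:E) +oo.

Definition liminf_abs (X : R -> T -> R) (w : T) : \bar R :=
  limf_einf (fun t => `|X t w|%:E) +oo.

Definition omega1 (I Y : R -> T -> R) : set T :=
  [set w | solution_event id 0 I Y w /\
           (0 < limsup_abs Y w)%E /\ (limsup_abs Y w < +oo)%E].

(* Pointwise (not essential) extrema over the event A. *)
Definition inf_limsup (A : set T) (X : R -> T -> R) : \bar R :=
  ereal_inf [set limsup_abs X w | w in A].

Definition sup_limsup (A : set T) (X : R -> T -> R) : \bar R :=
  ereal_sup [set limsup_abs X w | w in A].

End processes.

Section deterministic.
Context (R : realType).

Definition theta (sigma : R -> R) (n : nat) : R :=
  Num.sqrt (\int[lebesgue_measure]_(s in `[n%:R, n.+1%:R]) (sigma s ^+ 2)).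

Definition Sprime (sigma : R -> R) (eps : R) : \bar R :=
  (\sum_(0 <= n <oo)
     (if theta sigma n == 0 then 0
      else theta sigma n * expR (- (eps ^+ 2 / 2 * (theta sigma n ^+ 2)^-1)))%R%:E)%E.

(* The x >= 0 such that 2x + max_{|z| <= x} |f(z)| = y; it exists and is unique
   for continuous f with f(0) = 0 and y >= 0. *)
Definition xlower (f : R -> R) (y : R) : R :=
  xget 0 [set x | 0 <= x /\ 2 * x + sup [set `|f z| | z in `[- x, x]] = y].

Definition fplus (f : R -> R) (x : R) : R :=
  if x == 0 then 0 else sup [set z | 0 < z /\ f z = x].

Definition fminus (f : R -> R) (x : R) : R :=
  if x == 0 then 0 else inf [set z | z < 0 /\ f z = x].

Definition xupper (f : R -> R) (y : R) : R :=
  2 * y + Num.max (fplus f y) (- fminus f (- y)).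

End deterministic.

(* Main.v *)
(* Writing [I] for the stochastic integral, both [X - I] and [Y - I] are
   ordinary primitives, so all comparisons between [X], [Y] and the increments
   of [I] are pathwise: while [X - Y] exceeds a barrier, the sign of
   [Y - f X] makes it decrease at a linear rate.  This bounds [limsup |X|] by
   [limsup |Y|] and conversely, bounds [limsup |Y|] by the oscillation of [I]
   on unit intervals, and shows that [|X|] returns near 0 as soon as neither
   [I] nor [-I] eventually dominates a line of positive slope.

   The law of [I] enters only through dyadic Riemann sums of [sigma dB]: the
   exponential supermartingale gives the upper tail of their running maximum,
   and a Paley--Zygmund inequality conditional on the past gives a lower tail
   that multiplies over successive blocks.  Both estimates pass to the limit in
   probability, and Borel--Cantelli arguments then translate the convergence or
   divergence of [Sprime] into statements on the increments of [I]. *)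

Require Import Defs.
From HB Require Import structures.
From mathcomp Require Import all_boot all_order all_algebra.
From mathcomp Require Import all_classical all_reals all_analysis.
From mathcomp Require Import measurable_realfun.
From mathcomp Require Import ring lra.
Set Implicit Arguments.
Unset Strict Implicit.
Unset Printing Implicit Defensive.
Import Order.TTheory GRing.Theory Num.Theory.
Import numFieldNormedType.Exports.
Local Open Scope classical_set_scope.
Local Open Scope ring_scope.

(** * Pathwise comparison *)

Section half_line.
Context (R : realType).
Implicit Types (x y z h g f : R -> R).
Local Notation mu := lebesgue_measure.

(** The hypotheses give [I] only as an L^2 limit at each fixed time; its Gaussian law and the
    independence of its increments are never identified. Each probabilistic bound is proved for
    Riemann sums in terms of their discrete variance, and transferred to [I] with a small margin in
    the level and a union bound over finitely many times.

    This costs constants: tails such as exp(-x^2/(8u)) and levels such as a/5 are not sharp. They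
    suffice because (A) and (C) quantify over all [eps], and in (B) only positivity and finiteness
    of limsup |Y| have to be drawn from [eps']; the bounds on X in terms of Y are then pathwise.

    That [I] does not follow a line of positive slope rests on a dichotomy. If its total variance is
    finite, the maximal tail alone forbids it; if infinite, huge increments of the opposite sign
    occur along a sparse sequence of times. *)

Definition half_cont x := {within `[0, +oo[%classic, continuous x}.

Lemma half_contP x : half_cont x <->
  forall t : R, 0 <= t -> forall e : R, 0 < e ->
  exists2 n, 0 < n & forall u, 0 <= u -> `|u - t| < n -> `|x u - x t| < e.
Proof.
split.
  move=> /subspace_continuousP cx t t0 e e0.
  have /cx : `[0, +oo[%classic t by rewrite /= in_itv/= t0.
  move=> /cvgrPdist_lt/(_ e e0); rewrite /within/= -nbhs_nearE.
  move=> /nbhs_ballP[n /= n0 H]; exists n => // u u0 ut.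
  rewrite distrC; apply: H; rewrite /ball/= ?(distrC t)//.
  by rewrite in_itv/= u0.
move=> H; apply/subspace_continuousP => t; rewrite /= in_itv/= andbT => t0.
apply/cvgrPdist_lt => e e0; have [n n0 {}H] := H _ t0 _ e0.
rewrite /within/= -nbhs_nearE; apply/nbhs_ballP; exists n => //= u.
rewrite /ball/= => ut; rewrite in_itv/= andbT => u0.
by rewrite distrC; apply: H => //; rewrite distrC.
Qed.

Lemma half_cont_itv x (s t : R) : half_cont x -> 0 <= s -> {within `[s, t], continuous x}.
Proof.
move=> cx s0; apply: continuous_subspaceW cx => u /=.
by rewrite !in_itv/= andbT => /andP[/(le_trans s0)].
Qed.

Lemma half_contD x y : half_cont x -> half_cont y -> half_cont (fun t => x t + y t).
Proof. by move=> cx cy t; apply: continuousD; [exact: cx|exact: cy]. Qed.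

Lemma half_contN x : half_cont x -> half_cont (fun t => - x t).
Proof. by move=> cx t; apply: continuousN; exact: cx. Qed.

Lemma half_contB x y : half_cont x -> half_cont y -> half_cont (fun t => x t - y t).
Proof. by move=> cx cy; apply: half_contD => //; exact: half_contN. Qed.

Lemma half_cont_comp f x : continuous f -> half_cont x -> half_cont (fun t => f (x t)).
Proof. by move=> cf cx t; apply: continuous_comp; [exact: cx|exact: cf]. Qed.

Lemma half_cont_cst (c : R) : half_cont (fun=> c).
Proof. by move=> t; exact: cvg_cst. Qed.

Lemma half_cont_integrable x (s t : R) : half_cont x -> 0 <= s ->
  mu.-integrable `[s, t] (EFin \o x).
Proof.
move=> cx s0; apply: continuous_compact_integrable; first exact: segment_compact.
exact: half_cont_itv.
Qed.

Lemma Rintegral_le_cst h (s t c : R) : half_cont h -> 0 <= s -> s <= t ->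
  (forall u, s <= u <= t -> h u <= c) -> \int[mu]_(u in `[s, t]) h u <= c * (t - s).
Proof.
move=> ch s0 st H.
have -> : c * (t - s) = \int[mu]_(u in `[s, t]) (fun=> c) u.
  rewrite Rintegral_cst//=; congr (_ * _).
  rewrite lebesgue_measure_itv/= lte_fin.
  by case: ltgtP st => //= ->; rewrite subrr.
apply: le_Rintegral => //.
- exact: half_cont_integrable.
- by apply: half_cont_integrable => //; exact: half_cont_cst.
Qed.

Lemma Rintegral_itv_sub h (s t : R) : half_cont h -> 0 <= s -> s <= t ->
  \int[mu]_(u in `[0, t]) h u - \int[mu]_(u in `[0, s]) h u
  = \int[mu]_(u in `[s, t]) h u.
Proof.
move=> ch s0 st; rewrite Rintegral_itvB ?bnd_simp//; last exact: half_cont_integrable.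
rewrite Rintegral_itv_obnd_cbnd//.
apply: integrableS (half_cont_integrable t ch s0) => //.
by apply: subset_itvr; rewrite bnd_simp.
Qed.

(* The only trace of the relation [z' = h] needed for the comparison arguments. *)
Definition increment_bound z h := forall s t c : R, 0 <= s -> s <= t ->
  (forall u, s <= u <= t -> h u <= c) -> z t - z s <= c * (t - s).

Lemma primitive_increment_bound z h (c : R) : half_cont h ->
  (forall t, 0 <= t -> z t = c + \int[mu]_(u in `[0, t]) h u) ->
  increment_bound z h.
Proof.
move=> ch zE s t k s0 st hk.
rewrite !zE//; last exact: le_trans st.
rewrite opprD addrACA subrr add0r Rintegral_itv_sub//.
exact: Rintegral_le_cst.
Qed.

Lemma increment_bound_ext z z' h h' : z =1 z' -> h =1 h' ->
  increment_bound z h -> increment_bound z' h'.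
Proof. by move=> /funext <- /funext <-. Qed.

(** Consider the last time [T] in [a, b] with [z <= K]. Without such a time the linear decrease runs
    over all of [a, b]; after it [z] stays above [K] and can only decrease, so [z b] cannot exceed
    [K]. *)
Lemma barrier z h (a b K d : R) : half_cont z -> increment_bound z h ->
  0 <= a -> a <= b -> 0 <= d ->
  (forall u, a <= u <= b -> K <= z u -> h u <= - d) ->
  z b <= Num.max K (z a - d * (b - a)).
Proof.
move=> /half_contP cz zh a0 ab d0 H; rewrite leNgt; apply/negP.
rewrite gt_max => /andP[Kb dab].
pose S := [set t | a <= t <= b /\ z t <= K].
have decr u : a <= u <= b -> (forall v, u <= v <= b -> K < z v) ->
    z b <= z u - d * (b - u).
  move=> /andP[au ub] Hv.
  have := zh u b (- d) (le_trans a0 au) ub; rewrite mulNr lerBlDr addrC; apply.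
  move=> v uvb; apply: H; last exact/ltW/Hv.
  by case/andP: uvb => /(le_trans au) -> ->.
have [[s0 [s0ab Ks0]]|S0] := pselect (S !=set0); last first.
  have := decr a; rewrite lexx ab leNgt dab => /(_ isT) /=; apply/not_implyP.
  split => // v vab; rewrite ltNge; apply/negP => Kv; apply: S0; by exists v.
have hsS : has_sup S.
  by split; [exists s0|exists b => s [/andP[]]].
pose T := sup S.
have aT : a <= T.
  by apply: (@le_trans _ _ s0); [case/andP: s0ab|exact: ub_le_sup (proj2 hsS) _ _].
have Tb : T <= b by apply: ge_sup; [exists s0|move=> s [/andP[]]].
(* Half of the gap is spent on [z T - K], through points of [S] near [T], and half on [z u - z T]
   for some [u] just after [T]; then [z u < z b], against the decrease on [u, b]. *)
have e0 : 0 < (z b - K) / 2 by lra.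
have [n n0 near_T] := cz T (le_trans a0 aT) _ e0.
have [s Ss Ts] := sup_adherent n0 hsS.
have sT : s <= T by exact: ub_le_sup (proj2 hsS) _ Ss.
case: Ss => /andP[as_ sb] Ks.
have /near_T : 0 <= s by exact: le_trans as_.
rewrite ler0_norm ?subr_le0// => /(_ ltac:(rewrite -/T in Ts; lra)).
rewrite ltr_norml => /andP[zT _].
have Tb' : T < b.
  rewrite lt_neqAle Tb andbT; apply/eqP => Tb'; move: zT; rewrite Tb'; lra.
pose u := Num.min b (T + n / 2).
have Tu : T < u by rewrite lt_min Tb' ltrDl divr_gt0.
have ub : u <= b by rewrite ge_min lexx.
have uTn : u <= T + n / 2 by rewrite ge_min lexx orbT.
have /near_T : 0 <= u by rewrite (le_trans a0)// (le_trans aT)// ltW.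
rewrite ger0_norm ?subr_ge0 ?(ltW Tu)// => /(_ ltac:(lra)).
rewrite ltr_norml => /andP[_ zu].
have := decr u; rewrite ub (le_trans aT (ltW Tu)) => /(_ isT).
have dbu : 0 <= d * (b - u) by rewrite mulr_ge0// subr_ge0.
move=> zbu; suff : z b <= z u - d * (b - u) by lra.
apply: zbu => v /andP[uv vb]; rewrite ltNge; apply/negP => Kv.
suff /(lt_le_trans (lt_le_trans Tu uv)) : v <= T by rewrite ltxx.
apply: ub_le_sup; first exact: (proj2 hsS).
split => //; rewrite vb andbT (le_trans aT)// (le_trans (ltW Tu))//.
Qed.

Lemma eventually_below z h (K d T : R) : half_cont z -> increment_bound z h -> 0 < d ->
  (forall t, T <= t -> K <= z t -> h t <= - d) ->
  exists S, forall t, S <= t -> z t <= K.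
Proof.
move=> cz zh d0 H; pose a := Num.max T 0.
have a0 : 0 <= a by rewrite le_max lexx orbT.
have Ta : T <= a by rewrite le_max lexx.
exists (a + `|z a - K| / d) => t tS.
have at_ : a <= t by apply: le_trans tS; rewrite lerDl divr_ge0// ltW.
have /(_ _)/le_trans := @barrier z h a t K d cz zh a0 at_ (ltW d0).
apply; first by move=> u /andP[au _]; apply: H; exact: le_trans au.
rewrite ge_max lexx/= lerBlDr -lerBlDl.
apply: (@le_trans _ _ `|z a - K|); first exact: ler_norm.
by rewrite mulrC -ler_pdivrMr// lerBrDl.
Qed.

End half_line.

(** * Limsup and liminf at infinity as epsilon statements *)

Section limits_of_paths.
Context (R : realType).
Implicit Types (x : R -> R).

Lemma limsup_abs_path_le x (c : R) :
  (forall e, 0 < e -> exists T, forall t, T <= t -> `|x t| <= c + e) ->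
  (limf_esup (fun t => `|x t|%:E) +oo%R <= c%:E)%E.
Proof.
move=> H; apply/lee_addgt0Pr => e e0; have [T HT] := H _ e0.
apply: (@le_trans _ _ (ereal_sup ((fun t => `|x t|%:E) @` [set t | T <= t]))).
  apply: ereal_inf_lbound; exists [set t | T <= t] => //.
  by exists T; split; [exact: num_real|move=> t /= /ltW].
by apply: ge_ereal_sup => _ [t /= /HT tT <-]; rewrite -EFinD lee_fin.
Qed.

Lemma limsup_abs_path_lt x (c : R) :
  (limf_esup (fun t => `|x t|%:E) +oo%R < c%:E)%E ->
  exists T, forall t, T <= t -> `|x t| <= c.
Proof.
move=> /ereal_inf_lt[_ /= [V [T [_ VT]] <-]] Vc; exists (T + 1) => t tT.
rewrite -lee_fin (le_trans _ (ltW Vc))//; apply: ereal_sup_ubound.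
by exists t => //; apply: VT; rewrite (lt_le_trans _ tT)// ltrDl.
Qed.

Lemma limsup_abs_path_eq x (c : R) :
  limf_esup (fun t => `|x t|%:E) +oo%R = c%:E ->
  forall e, 0 < e -> exists T, forall t, T <= t -> `|x t| <= c + e.
Proof.
by move=> xc e e0; apply: limsup_abs_path_lt; rewrite xc lte_fin ltrDl.
Qed.

Lemma limsup_abs_path_ge0 x : (0 <= limf_esup (fun t => `|x t|%:E) +oo%R)%E.
Proof.
apply: limf_esup_ge0 => [[M [_ M0]]|t]; last by rewrite lee_fin.
by apply: (M0 (M + 1)); rewrite ltrDl.
Qed.

Lemma limsup_abs_path_pinfty x :
  (forall K T : R, exists2 t, T <= t & K < `|x t|) ->
  limf_esup (fun t => `|x t|%:E) +oo%R = +oo%E.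
Proof.
move=> H; have := limsup_abs_path_ge0 x.
case E: (limf_esup _ _) => [c| |]// _.
have [T HT] := limsup_abs_path_eq E ltr01.
by have [t /HT] := H (c + 1) T; rewrite leNgt => /negP.
Qed.

Lemma liminf_abs_path_eq0 x :
  (forall e T : R, 0 < e -> exists2 t, T <= t & `|x t| <= e) ->
  limf_einf (fun t => `|x t|%:E) +oo%R = 0%E.
Proof.
move=> H; rewrite limf_einfE; apply/eqP; rewrite eq_le; apply/andP; split.
  apply: ge_ereal_sup => _ [V [T [_ VT]] <-].
  apply/lee_addgt0Pr => e e0; rewrite add0e.
  have [t tT xt] := H e (T + 1) e0.
  apply: (@le_trans _ _ `|x t|%:E); last by rewrite lee_fin.
  apply: ereal_inf_lbound; exists t => //; apply: VT.
  by rewrite (lt_le_trans _ tT)// ltrDl.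
apply: le_ereal_sup_tmp; exists (ereal_inf ((fun t => `|x t|%:E) @` setT)).
  by exists setT => //; exists 0.
by apply: le_ereal_inf_tmp => _ [t _ <-]; rewrite lee_fin.
Qed.

End limits_of_paths.

(** * Reflection, coercivity and extreme preimages of the force *)

Section force.
Context (R : realType).
Implicit Types (f : R -> R).

(** Reflection: if x solves the equation with [f], xi and i, then -x solves it with [flip f], -xi
    and -i. One-sided estimates are thus proved once and applied twice. *)
Definition flip f : R -> R := fun z => - f (- z).

Lemma flip_continuous f : continuous f -> continuous (flip f).
Proof.
move=> cf z; apply: continuousN; apply: continuous_comp; last exact: cf.
exact: opp_continuous.
Qed.

Lemma continuous_bounded f (K : R) : continuous f ->
  exists M, forall z, `|z| <= K -> `|f z| <= M.
Proof.
move=> cf; have [K0|K0] := leP 0 K; last first.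
  by exists 0 => z zK; have := lt_le_trans K0 (normr_ge0 z); rewrite ltNge zK.
have cnf : {within `[- K, K], continuous (fun z => `|f z|)}.
  apply: continuous_subspaceT => z; apply: continuous_comp; first exact: cf.
  exact: norm_continuous.
have [c _ Hc] := EVT_max (ge0_cp K0).2 cnf.
by exists `|f c| => z; rewrite ler_norml => zK; apply: Hc; rewrite in_itv.
Qed.

Definition coercive f := forall A, exists M : R, forall z, M <= z -> A <= f z.

(** A strict inequality gives no rate of decrease; a uniform gap [d] does. It comes from the minimum
    of [f] on the compact stretch before coercivity takes over, and is capped at 1 beyond. *)
Lemma coercive_margin f (a y n : R) : continuous f -> coercive f -> 0 < n ->
  (forall z, a < z -> y < f z) ->
  exists2 d, 0 < d & forall z, a + n <= z -> y + d <= f z.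
Proof.
move=> cf cvf n0 H; have [M HM] := cvf (y + 1).
pose b := Num.max M (a + n).
have ab : a + n <= b by rewrite le_max lexx orbT.
have [c cab Hc] := EVT_min ab (continuous_subspaceT cf).
have yc : y < f c.
  apply: H; move: cab; rewrite in_itv/= => /andP[+ _].
  by apply: lt_le_trans; rewrite ltrDl.
exists (Num.min 1 (f c - y)); first by rewrite lt_min ltr01 subr_gt0.
move=> z az; have [zb|zb] := leP z b.
  apply: (@le_trans _ _ (f c)); last by apply: Hc; rewrite in_itv/= az.
  by rewrite -lerBrDl ge_min lexx orbT.
apply: (@le_trans _ _ (y + 1)); first by rewrite lerD2l ge_min lexx.
by apply: HM; rewrite (le_trans _ (ltW zb))// le_max lexx.
Qed.

Lemma fplus_ge0 f (y : R) : 0 <= fplus f y.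
Proof.
rewrite /fplus; case: ifP => // _.
have [[z [z0 fz]]|S0] := pselect ([set z | 0 < z /\ f z = y] !=set0).
  have [ubS|/sup_out-> //] := pselect (has_sup [set z | 0 < z /\ f z = y]).
  by rewrite (le_trans (ltW z0))//; apply: ub_le_sup; [case: ubS|].
by rewrite sup_out// => -[].
Qed.

(** [fplus f y] is the last positive preimage of y: a value [f z <= y] further right would, by
    coercivity and the intermediate value theorem, produce a later one. *)
Lemma fplus_gt f (y z : R) : continuous f -> coercive f -> 0 < y ->
  fplus f y < z -> y < f z.
Proof.
move=> cf cvf y0 yz; have z0 : 0 < z := le_lt_trans (fplus_ge0 f y) yz.
move: yz; rewrite /fplus gt_eqF// => yz; rewrite ltNge; apply/negP => fzy.
have [M HM] := cvf (y + 1).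
have [M0|M0] := leP M z.
  by have := HM _ M0; rewrite leNgt => /negP; apply; lra.
have [|c] := IVT (ltW M0) (continuous_subspaceT cf) (v := y).
  rewrite ge_min fzy/= le_max; apply/orP; right.
  by rewrite (le_trans _ (HM _ (lexx _)))// lerDl.
rewrite in_itv/= => /andP[zc _] fc.
suff : c <= sup [set z | 0 < z /\ f z = y] by rewrite leNgt (lt_le_trans yz).
apply: ub_le_sup; last by split => //; exact: lt_le_trans zc.
exists M => s [_ fs]; rewrite leNgt; apply/negP => /ltW/HM; rewrite fs leNgt.
by move=> /negP; apply; rewrite ltrDl.
Qed.

Lemma fminusE f (y : R) : fminus f (- y) = - fplus (flip f) y.
Proof.
rewrite /fminus /fplus oppr_eq0; case: ifP => _; first by rewrite oppr0.
rewrite /inf; congr (- sup _); apply/seteqP; split=> [_ [z [z0 fz] <-]|z [z0 fz]] /=.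
  by rewrite oppr_gt0 /flip opprK fz opprK.
by exists (- z); rewrite ?opprK// oppr_lt0; split => //; rewrite -fz opprK.
Qed.

End force.

(** * One-sided comparison estimates *)

Section increments.
Context (R : realType).
Implicit Types (x y f : R -> R) (n t T u z : R).

(** While x - y >= b + a + e/2, the bound y >= -(b + n) puts x above a + e/4, so f(x) >= b + d and
    the drift y - f(x) is at most n - d <= -d/2. Adding y <= b + n to the resulting bound on x - y
    gives the claim. *)
Lemma upper_estimate f x y (b a e : R) : continuous f -> coercive f ->
  half_cont x -> half_cont y -> increment_bound (fun t => x t - y t) (fun t => y t - f (x t)) ->
  (forall z, a < z -> b < f z) ->
  (forall n, 0 < n -> exists T, forall t, T <= t -> `|y t| <= b + n) ->
  0 < e -> exists T, forall t, T <= t -> x t <= 2 * b + a + e.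
Proof.
move=> cf cvf cx cy xy fab Hy e0.
have e4 : 0 < e / 4 by rewrite divr_gt0.
have [d d0 Hd] := coercive_margin cf cvf e4 fab.
have n0 : 0 < Num.min (d / 2) (e / 4) by rewrite lt_min e4 divr_gt0.
have [T HT] := Hy _ n0; set n := Num.min _ _ in n0 HT.
have nd : n <= d / 2 by rewrite ge_min lexx.
have ne : n <= e / 4 by rewrite ge_min lexx orbT.
have [|S HS] := @eventually_below R _ _ (b + a + e / 2) (d / 2) T
  (half_contB cx cy) xy (divr_gt0 d0 (ltr0n _ 2)).
  move=> t tT; have := HT _ tT; rewrite ler_norml => /andP[yt yt'] xyt.
  have := Hd (x t) ltac:(lra); lra.
exists (Num.max S T) => t; rewrite ge_max => /andP[/HS + /HT].
by rewrite ler_norml => + /andP[_]; lra.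
Qed.

(** Roles exchanged: if y - x >= c + M + e/2, then y >= M + 3e/8 while f(x) <= M + e/8, so y - x
    decreases. *)
Lemma lower_estimate f x y (c M e : R) : continuous f ->
  half_cont x -> half_cont y -> increment_bound (fun t => y t - x t) (fun t => f (x t) - y t) ->
  (forall z, `|z| <= c -> `|f z| <= M) -> 0 <= c ->
  (forall n, 0 < n -> exists T, forall t, T <= t -> `|x t| <= c + n) ->
  0 < e -> exists T, forall t, T <= t -> y t <= 2 * c + M + e.
Proof.
move=> cf cx cy yx fcM c0 Hx e0.
have e4 : 0 < e / 8 by rewrite divr_gt0.
(* Only |x| <= c + n is known, slightly beyond the range of [fcM]. Continuity of [f] at the end
   points c and -c extends the bound at the cost of e/8. *)
have margin u : `|u| <= c -> exists2 n, 0 < n & forall z, `|z - u| < n -> f z <= M + e / 8.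
  move=> uc; have := cf u => /cvgrPdist_lt/(_ _ e4)/nbhs_ballP[n /= n0 H].
  exists n => // z zu; have := H z; rewrite /ball/= distrC zu => /(_ isT).
  rewrite ltr_norml => /andP[+ _]; have := fcM _ uc; rewrite ler_norml => /andP[_].
  lra.
have [|n1 n10 H1] := margin c; first by rewrite ger0_norm.
have [|n2 n20 H2] := margin (- c); first by rewrite normrN ger0_norm.
have n0 : 0 < Num.min (Num.min n1 n2 / 2) (e / 8) by rewrite lt_min e4 divr_gt0// lt_min n10.
set n := Num.min _ _ in n0.
have nn1 : n <= n1 / 2.
  by rewrite ge_min; apply/orP; left; rewrite ler_pM2r ?invr_gt0// ge_min lexx.
have nn2 : n <= n2 / 2.
  by rewrite ge_min; apply/orP; left; rewrite ler_pM2r ?invr_gt0// ge_min lexx orbT.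
have ne : n <= e / 8 by rewrite ge_min lexx orbT.
have [T HT] := Hx _ n0.
have fx t : T <= t -> f (x t) <= M + e / 8.
  move=> /HT; rewrite ler_norml => /andP[xt1 xt2].
  have [xc|xc] := leP (x t) c; last by apply: H1; rewrite ltr_norml; apply/andP; lra.
  have [cx'|xc'] := leP (- c) (x t); last by apply: H2; rewrite ltr_norml; apply/andP; lra.
  have : `|f (x t)| <= M by apply: fcM; rewrite ler_norml cx'.
  rewrite ler_norml => /andP[_]; lra.
have [|S HS] := @eventually_below R _ _ (c + M + e / 2) (e / 8) T
  (half_contB cy cx) yx e4.
  move=> t tT; have := HT _ tT; rewrite ler_norml => /andP[xt1 xt2] yxt.
  have := fx _ tT; lra.
exists (Num.max S T) => t; rewrite ge_max => /andP[/HS + /HT].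
by rewrite ler_norml => + /andP[_]; lra.
Qed.

(** On a unit interval [i] moves by at most J, so as long as y - i >= 3J - i(n), y is at least 2J
    and y - i falls at rate 2J. At integer times y therefore loses J per step until it is below 4J;
    inside an interval one more J may be added, hence 5J. *)
Lemma ou_estimate y (i : R -> R) (J : R) (N : nat) : half_cont y -> half_cont i ->
  increment_bound (fun t => y t - i t) (fun t => - y t) -> 0 < J ->
  (forall (n : nat) t, (N <= n)%N -> n%:R <= t <= n.+1%:R -> `|i t - i n%:R| <= J) ->
  exists T, forall t, T <= t -> y t <= 5 * J.
Proof.
move=> cy ci yi J0 HJ.
have step (n : nat) t : (N <= n)%N -> n%:R <= t <= n.+1%:R ->
    y t <= Num.max (3 * J) (y n%:R - 2 * J * (t - n%:R)) + J.
  move=> Nn /[dup] tn /andP[nt tn1].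
  have nJ u : n%:R <= u <= t -> `|i u - i n%:R| <= J.
    by move=> /andP[nu ut]; apply: HJ => //; rewrite nu (le_trans ut).
  have := nJ t; rewrite nt lexx ler_norml => /(_ isT)/andP[_ it].
  have := @barrier R _ _ n%:R t (3 * J - i n%:R) (2 * J) (half_contB cy ci) yi
    (ler0n _ _) nt ltac:(lra).
  have /[swap]/[apply] : forall u, n%:R <= u <= t ->
      3 * J - i n%:R <= y u - i u -> - y u <= - (2 * J).
    by move=> u /nJ; rewrite ler_norml => /andP[iu _]; lra.
  rewrite le_max => /orP[h|h].
    suff : y t - J <= Num.max (3 * J) (y n%:R - 2 * J * (t - n%:R)) by lra.
    by rewrite le_max; apply/orP; left; lra.
  suff : y t - J <= Num.max (3 * J) (y n%:R - 2 * J * (t - n%:R)) by lra.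
  by rewrite le_max; apply/orP; right; lra.
have decay k : y (N + k)%:R <= Num.max (4 * J) (y N%:R - k%:R * J).
  elim: k => [|k IH]; first by rewrite addn0 mul0r subr0 le_max lexx orbT.
  have := step (N + k)%N (N + k.+1)%:R (leq_addr _ _).
  rewrite addnS ler_nat leqnSn lexx => /(_ isT).
  have -> : (N + k).+1%:R - (N + k)%:R = 1 :> R by rewrite -natr1 addrAC subrr add0r.
  rewrite mulr1 -(natr1 k) => h.
  apply: (le_trans h); rewrite -lerBrDr; rewrite ge_max; apply/andP; split.
    suff : 4 * J <= Num.max (4 * J) (y N%:R - (k%:R + 1) * J) by lra.
    by rewrite le_max lexx.
  move: IH; rewrite le_max => /orP[IH|IH].
    suff : 4 * J <= Num.max (4 * J) (y N%:R - (k%:R + 1) * J) by lra.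
    by rewrite le_max lexx.
  suff : y N%:R - (k%:R + 1) * J <= Num.max (4 * J) (y N%:R - (k%:R + 1) * J) by lra.
  by rewrite le_max lexx orbT.
pose k0 := (Num.truncn (`|y N%:R| / J)).+1.
have k0P k : (k0 <= k)%N -> y (N + k)%:R <= 4 * J.
  move=> kk; apply: (le_trans (decay k)); rewrite ge_max lexx/=.
  have : `|y N%:R| / J < k%:R.
    by apply: lt_le_trans (truncnS_gt _) _; rewrite ler_nat.
  rewrite ltr_pdivrMr// => h; have := ler_norm (y N%:R); lra.
exists (N + k0)%:R => t tk.
have t0 : 0 <= t by apply: le_trans tk.
have /andP[nt tn] := truncn_itv t0; set n := Num.truncn t in nt tn.
have Nn : (N + k0 <= n)%N by rewrite truncn_ge_nat.
have := step n t (leq_trans (leq_addr _ _) Nn); rewrite nt (ltW tn) => /(_ isT) h.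
apply: (le_trans h); rewrite -lerBrDr ge_max; apply/andP; split; first by lra.
have := k0P (n - N)%N; rewrite leq_subRL ?(leq_trans (leq_addr _ _) Nn)// => /(_ Nn).
rewrite subnKC ?(leq_trans (leq_addr _ _) Nn)// => yn.
suff : 0 <= 2 * J * (t - n%:R) by lra.
by rewrite mulr_ge0 ?subr_ge0//; lra.
Qed.

(** While x >= c the drift -f(x) is at most -d, so x becomes negative once i(t) falls below d t - C,
    where C is computed from the state at [T0]. *)
Lemma positive_path_contra f x (i : R -> R) (c : R) : continuous f -> coercive f ->
  (forall z, 0 < z -> 0 < f z) -> half_cont x ->
  increment_bound (fun t => x t - i t) (fun t => - f (x t)) -> 0 < c ->
  (forall d C T : R, 0 < d -> exists2 t, T <= t & i t < d * t - C) ->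
  forall T, exists2 t, T <= t & x t <= c.
Proof.
move=> cf cvf f0 cx xi c0 Hi T; apply: contrapT => H.
have xc t : T <= t -> c <= x t.
  by move=> Tt; rewrite leNgt; apply/negP => xt; apply: H; exists t => //; exact: ltW.
have [d d0 Hd] := coercive_margin cf cvf c0 f0.
pose T0 := Num.max T 0.
have [t tT it] := Hi d (x T0 - i T0 + d * T0) T0 d0.
have T00 : 0 <= T0 by rewrite le_max lexx orbT.
have := xi T0 t (- d) T00 tT.
have /[swap]/[apply] : forall u, T0 <= u <= t -> - f (x u) <= - d.
  move=> u /andP[uT _]; rewrite lerN2 -[leLHS]add0r Hd// add0r xc//.
  by rewrite (le_trans _ uT)// le_max lexx.
move=> h; have := xc t (le_trans _ tT); rewrite le_max lexx => /(_ isT) xtc.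
lra.
Qed.

Lemma increment_estimate f x (i : R -> R) (K M s t : R) : 
  increment_bound (fun t => x t - i t) (fun t => - f (x t)) ->
  (forall z, `|z| <= K -> `|f z| <= M) -> 0 <= s -> s <= t ->
  (forall u, s <= u <= t -> `|x u| <= K) -> i s - i t <= 2 * K + M * (t - s).
Proof.
move=> xi fKM s0 st HK; have := xi s t M s0 st.
have /[swap]/[apply] : forall u, s <= u <= t -> - f (x u) <= M.
  by move=> u /HK/fKM; rewrite ler_norml => /andP[+ _]; lra.
have := HK s; rewrite lexx st => /(_ isT); rewrite ler_norml => /andP[_ +].
have := HK t; rewrite lexx st => /(_ isT); rewrite ler_norml => /andP[+ _].
lra.
Qed.

End increments.

(** * Two-sided estimates for solutions driven by the same path *)

Section pathwise.
Context (R : realType) (f : R -> R) (xi : R) (i x y : R -> R).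
Implicit Types (e n t T u z : R).
Local Notation mu := lebesgue_measure.
Hypotheses (cf : continuous f) (f_pos : forall z, z != 0 -> 0 < z * f z).
Hypotheses (f_coercive : coercive f) (flip_coercive : coercive (flip f)).
Hypotheses (ci : half_cont i) (cx : half_cont x) (cy : half_cont y).
Hypothesis x_eq : forall t, 0 <= t ->
  x t = xi - \int[mu]_(s in `[0, t]) f (x s) + i t.
Hypothesis y_eq : forall t, 0 <= t ->
  y t = 0 - \int[mu]_(s in `[0, t]) y s + i t.

Let cfx : half_cont (fun t => f (x t)).
Proof. exact: half_cont_comp. Qed.

Let intN (h : R -> R) t : half_cont h -> 0 <= t ->
  \int[mu]_(s in `[0, t]) (- h s) = - \int[mu]_(s in `[0, t]) h s.
Proof.
move=> ch t0; under eq_Rintegral do rewrite -mulN1r.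
by rewrite RintegralZl// ?mulN1r//; exact: half_cont_integrable.
Qed.

Let intB (h k : R -> R) t : half_cont h -> half_cont k -> 0 <= t ->
  \int[mu]_(s in `[0, t]) (h s - k s) =
  \int[mu]_(s in `[0, t]) h s - \int[mu]_(s in `[0, t]) k s.
Proof. by move=> ch ck t0; rewrite RintegralB//; exact: half_cont_integrable. Qed.

Let xi_incr : increment_bound (fun t => x t - i t) (fun t => - f (x t)).
Proof.
apply: (@primitive_increment_bound _ _ _ xi); first exact: half_contN.
by move=> t t0; rewrite x_eq// intN//; ring.
Qed.

Let xiN_incr : increment_bound (fun t => - x t - - i t) (fun t => f (x t)).
Proof.
apply: (@primitive_increment_bound _ _ _ (- xi)) => //.
by move=> t t0; rewrite x_eq//; ring.
Qed.

Let yi_incr : increment_bound (fun t => y t - i t) (fun t => - y t).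
Proof.
apply: (@primitive_increment_bound _ _ _ 0); first exact: half_contN.
by move=> t t0; rewrite {1}y_eq// intN//; ring.
Qed.

Let yiN_incr : increment_bound (fun t => - y t - - i t) (fun t => y t).
Proof.
apply: (@primitive_increment_bound _ _ _ 0) => //.
by move=> t t0; rewrite {1}y_eq//; ring.
Qed.

Let xy_incr : increment_bound (fun t => x t - y t) (fun t => y t - f (x t)).
Proof.
apply: (@primitive_increment_bound _ _ _ xi); first exact: half_contB.
by move=> t t0; rewrite {1}y_eq// x_eq// intB//; ring.
Qed.

Let yx_incr : increment_bound (fun t => y t - x t) (fun t => f (x t) - y t).
Proof.
apply: (@primitive_increment_bound _ _ _ (- xi)); first exact: half_contB.
by move=> t t0; rewrite {1}y_eq// x_eq// intB//; ring.
Qed.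

Let f_gt0 z : 0 < z -> 0 < f z.
Proof. by move=> z0; rewrite -(pmulr_rgt0 _ z0) f_pos// gt_eqF. Qed.

Let flip_gt0 z : 0 < z -> 0 < flip f z.
Proof.
move=> z0; have := @f_pos (- z); rewrite oppr_eq0 gt_eqF// => /(_ isT).
by rewrite mulNr -mulrN pmulr_rgt0.
Qed.

Lemma solution_upper (b a a' : R) :
  (forall z, a < z -> b < f z) -> (forall z, a' < z -> b < flip f z) ->
  (forall n, 0 < n -> exists T, forall t, T <= t -> `|y t| <= b + n) ->
  forall e, 0 < e ->
  exists T, forall t, T <= t -> `|x t| <= 2 * b + Num.max a a' + e.
Proof.
move=> fa fa' Hy e e0.
have [T HT] := upper_estimate cf f_coercive cx cy xy_incr fa Hy e0.
have [||T' HT'] := upper_estimate (flip_continuous cf) flip_coercive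
    (half_contN cx) (half_contN cy) _ fa' _ e0.
- apply: increment_bound_ext yx_incr => t; first by ring.
  by rewrite /flip !opprK; ring.
- by move=> n /Hy[S HS]; exists S => t /HS; rewrite normrN.
exists (Num.max T T') => t; rewrite ge_max => /andP[/HT xt /HT' xt'].
have am : a <= Num.max a a' by rewrite le_max lexx.
have am' : a' <= Num.max a a' by rewrite le_max lexx orbT.
by rewrite ler_norml; apply/andP; split; lra.
Qed.

Lemma solution_lower (c M : R) : 0 <= c ->
  (forall z, `|z| <= c -> `|f z| <= M) ->
  (forall n, 0 < n -> exists T, forall t, T <= t -> `|x t| <= c + n) ->
  forall e, 0 < e -> exists T, forall t, T <= t -> `|y t| <= 2 * c + M + e.
Proof.
move=> c0 fM Hx e e0.
have [T HT] := lower_estimate cf cx cy yx_incr fM c0 Hx e0.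
have [|||T' HT'] := @lower_estimate _ (flip f) _ _ c M e (flip_continuous cf)
    (half_contN cx) (half_contN cy) _ _ c0 _ e0.
- apply: increment_bound_ext xy_incr => t; first by ring.
  by rewrite /flip !opprK; ring.
- by move=> z zc; rewrite /flip normrN fM// normrN.
- by move=> n /Hx[S HS]; exists S => t /HS; rewrite normrN.
exists (Num.max T T') => t; rewrite ge_max => /andP[/HT xt /HT' xt'].
by rewrite ler_norml; apply/andP; split; lra.
Qed.

Lemma solution_ou (J : R) (N : nat) : 0 < J ->
  (forall (n : nat) t, (N <= n)%N -> n%:R <= t <= n.+1%:R -> `|i t - i n%:R| <= J) ->
  exists T, forall t, T <= t -> `|y t| <= 5 * J.
Proof.
move=> J0 HJ; have [T HT] := ou_estimate cy ci yi_incr J0 HJ.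
have [||T' HT'] := @ou_estimate _ _ _ J N (half_contN cy) (half_contN ci) _ J0.
- by apply: increment_bound_ext yiN_incr => t //; rewrite opprK.
- by move=> n t Nn nt; rewrite -opprD normrN HJ.
exists (Num.max T T') => t; rewrite ge_max => /andP[/HT yt /HT' yt'].
by rewrite ler_norml; apply/andP; split; lra.
Qed.

(** The equation read backwards: the driving path moves by at most the displacement of x plus the
    accumulated drift. Large increments of [i] thus keep x from staying small. *)
Lemma solution_increment (K M T s t : R) :
  (forall z, `|z| <= K -> `|f z| <= M) -> (forall t, T <= t -> `|x t| <= K) ->
  0 <= s -> T <= s -> s <= t -> `|i t - i s| <= 2 * K + M * (t - s).
Proof.
move=> fM HT s0 Ts st.
have Hx u : s <= u <= t -> `|x u| <= K by move=> /andP[/(le_trans Ts)/HT].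
have h1 := increment_estimate xi_incr fM s0 st Hx.
have h2 : - i s - - i t <= 2 * K + M * (t - s).
  apply: (@increment_estimate _ (flip f) (fun u => - x u) (fun u => - i u)) => //.
  - by apply: increment_bound_ext xiN_incr => u //; rewrite /flip !opprK.
  - by move=> z zc; rewrite /flip normrN fM// normrN.
  - by move=> u /Hx; rewrite normrN.
by rewrite ler_norml; apply/andP; split; lra.
Qed.

(** If |x| > e from some time on, continuity fixes the sign of x; the positive case contradicts the
    first hypothesis, the negative one the second after reflection. *)
Lemma solution_liminf :
  (forall d C T : R, 0 < d -> exists2 t, T <= t & i t < d * t - C) ->
  (forall d C T : R, 0 < d -> exists2 t, T <= t & - i t < d * t - C) ->
  forall e T, 0 < e -> exists2 t, T <= t & `|x t| <= e.
Proof.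
move=> Hi HiN e T e0; apply: contrapT => H.
pose T0 := Num.max T 0.
have TT0 : T <= T0 by rewrite le_max lexx.
have T00 : 0 <= T0 by rewrite le_max lexx orbT.
have xe t : T0 <= t -> e < `|x t|.
  by move=> Tt; rewrite ltNge; apply/negP => xt; apply: H; exists t => //; exact: le_trans Tt.
have no_zero t : T0 <= t -> Num.min (x T0) (x t) <= 0 <= Num.max (x T0) (x t) -> False.
  move=> Tt; have cxT := half_cont_itv (t := t) cx T00.
  move=> /(IVT Tt cxT)[u]; rewrite in_itv/= => /andP[/xe + _] xu.
  by rewrite xu normr0 ltNge (ltW e0).
have [xT|xT] := leP 0 (x T0).
  have [t tT xt] := positive_path_contra cf f_coercive f_gt0 cx xi_incr e0 Hi T0.
  apply: (no_zero _ tT); rewrite ge_min le_max xT andbT; apply/orP; right.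
  have := xe _ tT; have [//|x0] := leP (x t) 0.
  by rewrite gtr0_norm// ltNge xt.
have [|t tT xt] := @positive_path_contra _ (flip f) (fun t => - x t) (fun t => - i t) e
    (flip_continuous cf) flip_coercive flip_gt0 (half_contN cx) _ e0 HiN T0.
  by apply: increment_bound_ext xiN_incr => t //; rewrite /flip !opprK.
apply: (no_zero _ tT); rewrite ge_min le_max (ltW xT)/=; apply/orP; right.
have := xe _ tT; have [//|x0] := leP 0 (x t).
by rewrite ltr0_norm// ltNge xt.
Qed.

End pathwise.

(** * Exponential estimates for weighted sums of independent variables *)

Section independence.
Context d (T : measurableType d) (R : realType) (P : probability T R).
Local Open Scope ereal_scope.

(** The joint law of (U, V) agrees with the product law on rectangles, hence everywhere; Tonelli
    then factors the integral. *)
Lemma integral_prod_independent (U V : T -> R) :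
  measurable_fun setT U -> measurable_fun setT V ->
  (forall w, 0 <= U w)%R -> (forall w, 0 <= V w)%R ->
  (forall A B : set R, measurable A -> measurable B ->
     P (U @^-1` A `&` V @^-1` B) = P (U @^-1` A) * P (V @^-1` B)) ->
  \int[P]_w (U w * V w)%:E = \int[P]_w (U w)%:E * \int[P]_w (V w)%:E.
Proof.
move=> mU mV U0 V0 indep.
pose X := [the {RV P >-> R} of mfun_Sub (mem_set mU)].
pose Y := [the {RV P >-> R} of mfun_Sub (mem_set mV)].
have mXY : measurable_fun setT (fun w => (X w, Y w)) by exact: measurable_fun_pair.
pose XY := [the {mfun T >-> (R * R)%type} of mfun_Sub (mem_set mXY)].
(* The absolute values make the integrand nonnegative on the whole plane, as Tonelli requires, and
   change nothing on the range of (U, V). *)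
pose g (z : R * R) : \bar R := (`|z.1| * `|z.2|)%:E.
have mg : measurable_fun setT g.
  apply/measurable_EFinP; apply: measurable_funM.
    exact: (measurableT_comp (@normr_measurable R setT) measurable_fst).
  exact: (measurableT_comp (@normr_measurable R setT) measurable_snd).
have mnorm : measurable_fun setT (fun x : R => `|x|%:E).
  by apply/measurable_EFinP; exact: (@normr_measurable R setT).
have pushU (Z : {mfun T >-> R}) : (forall w, 0 <= Z w)%R ->
    \int[distribution P Z]_x `|x|%:E = \int[P]_w (Z w)%:E.
  move=> Z0; rewrite ge0_integral_pushforward//=.
  by apply: eq_integral => w _ /=; rewrite ger0_norm.
have -> : \int[P]_w (U w * V w)%:E = \int[distribution P XY]_z g z.
  rewrite ge0_integral_pushforward//=.
    by apply: eq_integral => w _; rewrite /g/= !ger0_norm.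
  by move=> z _; rewrite lee_fin mulr_ge0.
rewrite (@eq_measure_integral _ _ _ _ (distribution P X \x distribution P Y)); last first.
  move=> A mA _; apply/esym; by apply: product_measure_unique => // B C mB mC; exact: indep.
rewrite fubini_tonelli1//= /fubini_F/= /g/=; last first.
  by move=> z; rewrite lee_fin mulr_ge0.
under eq_integral => x _.
  under eq_integral do rewrite EFinM.
  rewrite ge0_integralZl//.
  rewrite (pushU Y)//.
  over.
rewrite ge0_integralZr//; last by apply: integral_ge0 => w _; rewrite lee_fin V0.
by rewrite (pushU X).
Qed.

End independence.

(** * Conditioning on the past and exponential bounds for partial sums *)

Section independent_sequence.
Context d (T : measurableType d) (R : realType) (P : probability T R).
Variable D : nat -> T -> R.
Hypothesis mD : forall i, measurable_fun setT (D i).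
Hypothesis indD : forall n (A : nat -> set R), (forall i, measurable (A i)) ->
  (P (\bigcap_(i < n) D i @^-1` A i) = \prod_(i < n) P (D i @^-1` A i))%E.

(** A pi-system generating the sigma-algebra of the first [k] variables, shaped so that [indD]
    applies to it directly. *)
Definition rectangle k : set (set T) :=
  [set E | exists2 A : nat -> set R, (forall i, measurable (A i)) &
    E = \bigcap_(i < k) D i @^-1` A i].

Notation past k := <<s rectangle k >>.

Lemma rectangle_measurable k : rectangle k `<=` measurable.
Proof.
move=> _ [A mA ->]; apply: fin_bigcap_measurable => // i _.
by rewrite -[X in measurable X]setTI; exact: mD.
Qed.

Lemma past_measurable k : past k `<=` measurable.
Proof.
by apply: smallest_sub; [exact: sigma_algebra_measurable|exact: rectangle_measurable].
Qed.

Lemma rectangle_mono k l : (k <= l)%N -> rectangle k `<=` rectangle l.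
Proof.
move=> kl _ [A mA ->]; exists (fun i => if (i < k)%N then A i else setT).
  by move=> i; case: ifP.
apply/seteqP; split => w /= H i il; first by case: ifP => // ik; exact: H.
by have := H i (leq_trans il kl); rewrite il.
Qed.

Lemma past_mono k l : (k <= l)%N -> past k `<=` past l.
Proof.
move=> kl; apply: smallest_sub; first exact: smallest_sigma_algebra.
by move=> E kE; apply: sub_sigma_algebra; exact: rectangle_mono kE.
Qed.

Lemma rectangle_setT k : rectangle k setT.
Proof. by exists (fun=> setT) => //; apply/seteqP; split. Qed.

Lemma rectangle_setI k : setI_closed (rectangle k).
Proof.
move=> _ _ [A mA ->] [B mB ->]; exists (fun i => A i `&` B i).
  by move=> i; exact: measurableI.
by rewrite -bigcapI.
Qed.

(** As functions of [E] both sides are finite measures, a restriction and a multiple of [P], and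
    they agree on the pi-system of rectangles. *)
Lemma past_independent k E A : past k E -> measurable A ->
  (P (E `&` D k @^-1` A) = P E * P (D k @^-1` A))%E.
Proof.
move=> kE mA.
have mDA : measurable (D k @^-1` A) by rewrite -[X in measurable X]setTI; exact: mD.
have pfin : P (D k @^-1` A) \is a fin_num by exact: fin_num_measure.
pose m1 := mrestr P mDA.
pose p : {nonneg R} := NngNum (fine_ge0 (measure_ge0 P (D k @^-1` A))).
pose m2 := mscale p P.
suff : m1 E = m2 E by rewrite /m1 /m2 /mrestr /mscale /= fineK// muleC.
apply: (g_sigma_algebra_measure_unique (rectangle k) _ (fun=> setT)) kE.
- exact: rectangle_measurable.
- by move=> _; exact: rectangle_setT.
- by apply/seteqP; split => // w _; exists 0%N.
- exact: rectangle_setI.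
- move=> _ [B mB ->].
  change (P ((\bigcap_(i < k) D i @^-1` B i) `&` D k @^-1` A) =
    (fine (P (D k @^-1` A)))%:E * P (\bigcap_(i < k) D i @^-1` B i))%E.
  rewrite fineK//.
  pose C i := if i == k then A else B i.
  have mC i : measurable (C i) by rewrite /C; case: ifP.
  have CB i : (i < k)%N -> C i = B i by rewrite /C; case: eqP => // ->; rewrite ltnn.
  have Ck : C k = A by rewrite /C eqxx.
  have := indD k.+1 mC; rewrite big_ord_recr/= Ck muleC.
  under eq_bigr do rewrite CB//.
  rewrite -indD// bigcap_mkord big_ord_recr/= Ck.
  under eq_bigr do rewrite CB//.
  by rewrite bigcap_mkord.
- move=> _; change (P (setT `&` D k @^-1` A) < +oo)%E.
  by rewrite setTI (le_lt_trans (probability_le1 _ _))// ltry.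
Qed.

Lemma past_D i k : (i < k)%N ->
  measurable_fun (setT : set (g_sigma_algebraType (rectangle k))) (D i).
Proof.
move=> ik _ A mA; rewrite setTI; apply: sub_sigma_algebra.
exists (fun j => if j == i then A else setT); first by move=> j; case: ifP.
apply/seteqP; split => [w Aw j jk /=|w /(_ i ik)]; last by rewrite eqxx.
by case: eqP => // ->.
Qed.

Definition past_fun k (U : T -> R) :=
  measurable_fun (setT : set (g_sigma_algebraType (rectangle k))) U.

Lemma past_fun_measurable k U : past_fun k U -> measurable_fun setT U.
Proof. by move=> mU _ A mA; apply: (@past_measurable k); exact: mU. Qed.

Lemma past_step k (U : T -> R) (h : R -> R) : past_fun k U ->
  (forall w, 0 <= U w) -> measurable_fun setT h -> (forall x, 0 <= h x) ->
  (\int[P]_w (U w * h (D k w))%:E =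
   \int[P]_w (U w)%:E * \int[P]_w (h (D k w))%:E)%E.
Proof.
move=> mU U0 mh h0; apply: integral_prod_independent => //.
- exact: past_fun_measurable mU.
- exact: (measurableT_comp mh).
- move=> A B mA mB.
  rewrite -[(fun w => _) @^-1` B]/(D k @^-1` (h @^-1` B)).
  apply: past_independent.
    by have := mU measurableT _ mA; rewrite setTI.
  by have := mh measurableT _ mB; rewrite setTI.
Qed.

Variables (c v : nat -> R).
Hypothesis v0 : forall i, 0 <= v i.
Hypothesis mgfD : forall i l,
  (\int[P]_w (expR (l * (c i * D i w)))%:E = (expR (l ^+ 2 * v i / 2))%:E)%E.

Definition psum (a n : nat) w : R := \sum_(a <= i < a + n) c i * D i w.
Definition pvar (a n : nat) : R := \sum_(a <= i < a + n) v i.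

Lemma psum0 a w : psum a 0 w = 0.
Proof. by rewrite /psum addn0 big_geq. Qed.

Lemma psumS a n w : psum a n.+1 w = psum a n w + c (a + n)%N * D (a + n)%N w.
Proof. by rewrite /psum addnS big_nat_recr//= leq_addr. Qed.

Lemma psum_sub a n w : psum a n w = psum 0 (a + n) w - psum 0 a w.
Proof.
rewrite /psum !add0n (@big_cat_nat _ _ _ a 0 (a + n)) ?leq_addr//=.
by rewrite addrAC subrr add0r.
Qed.

Lemma pvarS a n : pvar a n.+1 = pvar a n + v (a + n)%N.
Proof. by rewrite /pvar addnS big_nat_recr//= leq_addr. Qed.

Lemma past_fun_psum a n k : (a + n <= k)%N -> past_fun k (psum a n).
Proof.
elim: n k => [|n IH] k ank.
  rewrite (_ : psum a 0 = cst 0); first exact: measurable_cst.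
  by apply/funext => w; rewrite psum0.
rewrite (_ : psum a n.+1 = (fun w => psum a n w + c (a + n)%N * D (a + n)%N w)); last first.
  by apply/funext => w; rewrite psumS.
apply: measurable_funD; first by apply: IH; rewrite (leq_trans _ ank)// leq_add2l.
apply: measurable_funM; first exact: measurable_cst.
by apply: past_D; rewrite (leq_trans _ ank)// addnS.
Qed.

(** The factor [\1_E] is what makes later bounds iterable: [E] will be the event that all earlier
    blocks were calm. *)
Lemma mgf_past E a n l : past a E ->
  (\int[P]_w (\1_E w * expR (l * psum a n w))%:E =
   P E * (expR (l ^+ 2 * pvar a n / 2))%:E)%E.
Proof.
move=> aE; elim: n => [|n IH].
  rewrite /pvar addn0 big_geq// mulr0 mul0r expR0 mule1.
  under eq_integral do rewrite psum0 mulr0 expR0 mulr1.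
  by rewrite integral_indic ?setIT//; exact: past_measurable aE.
have splitE w : \1_E w * expR (l * psum a n.+1 w) =
    \1_E w * expR (l * psum a n w) * expR (l * (c (a + n)%N * D (a + n)%N w)).
  by rewrite psumS mulrDr expRD -[RHS]mulrA.
under eq_integral do rewrite splitE.
have /= -> := @past_step (a + n) (fun w => \1_E w * expR (l * psum a n w))
  (fun x => expR (l * (c (a + n)%N * x))) _ _ _ _.
- rewrite IH mgfD -muleA -EFinM -expRD pvarS; congr (_ * (expR _)%:E)%E.
  by rewrite mulrDr mulrDl.
- apply: measurable_funM.
    apply: measurable_indic; exact: past_mono (leq_addr _ _) _ aE.
  apply: (measurableT_comp (@measurable_expR R)).
  apply: measurable_funM; first exact: measurable_cst.
  exact: past_fun_psum.
- by move=> w; rewrite mulr_ge0// expR_ge0.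
- apply: (measurableT_comp (@measurable_expR R)).
  by apply: measurable_funM => //; exact: measurable_funM.
- by move=> w; rewrite expR_ge0.
Qed.

Lemma pvar_ge0 a n : 0 <= pvar a n.
Proof. exact: sumr_ge0. Qed.



Lemma past_superlevel a n k l x : (a + n <= k)%N ->
  past k [set w | x <= l * psum a n w].
Proof.
move=> ank.
have mS : past_fun k (fun w => l * psum a n w).
  by apply: measurable_funM; [exact: measurable_cst|exact: past_fun_psum].
have := mS measurableT _ (measurable_itv `[x, +oo[); rewrite setTI.
suff -> : (fun w => l * psum a n w) @^-1` `[x, +oo[ = [set w | x <= l * psum a n w] by [].
by apply/seteqP; split => w /=; rewrite in_itv/= andbT.
Qed.

Lemma measurable_expR_psum a n l : measurable_fun setT (fun w => expR (l * psum a n w)).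
Proof.
apply: (measurableT_comp (@measurable_expR R)).
apply: measurable_funM; first exact: measurable_cst.
exact: past_fun_measurable (past_fun_psum (leqnn _)).
Qed.

Definition passage a l x n : set T :=
  [set w | exists2 k, (k <= n)%N & x <= l * psum a k w].

Lemma passageS a l x n :
  passage a l x n.+1 = passage a l x n `|` [set w | x <= l * psum a n.+1 w].
Proof.
apply/seteqP; split => w /=.
  by move=> [k]; rewrite leq_eqVlt => /predU1P[->|kn]; [right|left; exists k].
by move=> [[k kn xk]|xn]; [exists k => //; exact: leqW|exists n.+1].
Qed.

Lemma past_passage a l x n : past (a + n) (passage a l x n).
Proof.
elim: n => [|n IH].
  rewrite (_ : passage a l x 0 = [set w | x <= l * psum a 0 w]).
    exact: past_superlevel.
  apply/seteqP; split => w /=; last by exists 0%N.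
  by move=> [k]; rewrite leqn0 => /eqP ->.
rewrite passageS; apply: (@measurableU _ (g_sigma_algebraType (rectangle (a + n.+1)))).
  by apply: past_mono IH; rewrite leq_add2l.
exact: past_superlevel.
Qed.

(* The exponential supermartingale stopped on its first passage above [x]. *)
Lemma stopped_mgf a l x n :
  (\int[P]_w (\1_(~` passage a l x n) w * expR (l * psum a n w)
     + expR x * \1_(passage a l x n) w)%:E <= (expR (l ^+ 2 * pvar a n / 2))%:E)%E.
Proof.
have mpas k : measurable (passage a l x k) by exact: past_measurable (@past_passage a l x k).
elim: n => [|n IH].
  rewrite /pvar addn0 big_geq// mulr0 mul0r expR0.
  have -> : 1%:E = (\int[P]_w (cst 1%E w))%E :> \bar R.
    by rewrite integral_cst//= mul1e probability_setT.
  apply: ge0_le_integral => //=.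
  - apply/measurable_EFinP; apply: measurable_funD; apply: measurable_funM => //.
    + exact/measurable_indic/measurableC.
    + exact: measurable_expR_psum.
  - move=> w _; rewrite lee_fin psum0 mulr0 expR0 mulr1 !indicE in_setC.
    case: (boolP (w \in passage a l x 0)) => /=; last by rewrite mulr0 addr0.
    rewrite inE => -[k]; rewrite leqn0 => /eqP ->; rewrite psum0 mulr0 => x0.
    by rewrite mulr1 add0r -[leRHS]expR0 ler_expR.
pose F := fun w => \1_(~` passage a l x n) w * expR (l * psum a n w).
pose G := fun w => F w * expR (l * (c (a + n)%N * D (a + n)%N w)).
have mF : past_fun (a + n) F.
  apply: measurable_funM.
    by apply/measurable_indic/measurableC; exact: past_passage.
  apply: (measurableT_comp (@measurable_expR R)).
  apply: measurable_funM; first exact: measurable_cst.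
  exact: past_fun_psum.
have mh : measurable_fun setT (fun z => expR (l * (c (a + n)%N * z))).
  apply: (measurableT_comp (@measurable_expR R)).
  by apply: measurable_funM => //; exact: measurable_funM.
have F0 w : 0 <= F w by rewrite mulr_ge0// expR_ge0.
have G0 w : 0 <= G w by rewrite mulr_ge0// expR_ge0.
have mG : measurable_fun setT G.
  apply: measurable_funM; first exact: past_fun_measurable mF.
  exact: (measurableT_comp mh).
apply: (@le_trans _ _ (\int[P]_w (G w + expR x * \1_(passage a l x n) w)%:E)%E).
  apply: ge0_le_integral => //=.
  - apply/measurable_EFinP; apply: measurable_funD; apply: measurable_funM => //.
    + exact/measurable_indic/measurableC.
    + exact: measurable_expR_psum.
  - apply/measurable_EFinP; apply: measurable_funD => //.
    by apply: measurable_funM => //; exact: measurable_indic.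
  (* A path whose first passage is at step n + 1 contributes e^x on the left and its own
     exponential, which is at least e^x, on the right. *)
  - move=> w _; rewrite lee_fin /G /F -mulrA -expRD -mulrDr -psumS !indicE !in_setC.
    rewrite passageS in_setU.
    case: (boolP (w \in passage a l x n)) => //=; rewrite ?mul0r ?add0r//.
    move=> _; case: (boolP (w \in _)) => /=; rewrite ?mul0r ?mulr0 ?mul1r ?mulr1 ?add0r ?addr0//.
    by rewrite inE/= ler_expR.
have mE : measurable_fun setT (fun w => (expR x * \1_(passage a l x n) w)%:E).
  by apply/measurable_EFinP; apply: measurable_funM => //; exact: measurable_indic.
have E0 w : (0 <= (expR x * \1_(passage a l x n) w)%:E)%E.
  by rewrite lee_fin mulr_ge0// expR_ge0.
under eq_integral do rewrite EFinD.
rewrite ge0_integralD//=; last 2 first.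
- by move=> w _; rewrite lee_fin.
- exact/measurable_EFinP.
have -> := past_step mF F0 mh (fun=> expR_ge0 _).
move: IH; under eq_integral do rewrite EFinD.
rewrite ge0_integralD//=; last first.
  by apply/measurable_EFinP; exact: past_fun_measurable mF.
rewrite mgfD pvarS mulrDr mulrDl expRD EFinM => IH.
(* Only the running part [A] acquires the factor [m] in this step; since [m >= 1], the stopped part
   [B] may be multiplied by it too, which closes the induction. *)
set m := (expR (l ^+ 2 * v (a + n)%N / 2))%:E.
have m1 : (1 <= m)%E 
  by rewrite lee_fin -[leLHS]expR0 ler_expR divr_ge0// mulr_ge0// sqr_ge0.
have m0 : (0 <= m)%E by exact: le_trans m1.
pose A := (\int[P]_w (F w)%:E)%E.
pose B := (\int[P]_w (expR x * \1_(passage a l x n) w)%:E)%E.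
have A0 : (0 <= A)%E by apply: integral_ge0 => w _; rewrite lee_fin F0.
have B0 : (0 <= B)%E by apply: integral_ge0 => w _; rewrite E0.
have IH' : (A + B <= (expR (l ^+ 2 * pvar a n / 2))%:E)%E := IH.
apply: le_trans (lee_wpmul2r m0 IH'); rewrite -/A -/B.
have -> : ((A + B) * m = A * m + B * m)%E by exact: ge0_muleDl.
by apply: leeD2l; exact: lee_pemulr.
Qed.

(** Chernoff bound for the running maximum, with [l] left free: the integrand of [stopped_mgf]
    equals e^x on the passage event. *)
Lemma passage_probability a l x n :
  (P (passage a l x n) <= (expR (l ^+ 2 * pvar a n / 2 - x))%:E)%E.
Proof.
have mpas : measurable (passage a l x n) by exact: past_measurable (@past_passage a l x n).
have := stopped_mgf a l x n.
move=> /(le_trans _) H.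
have : ((expR x)%:E * P (passage a l x n) <= (expR (l ^+ 2 * pvar a n / 2))%:E)%E.
  apply: H; rewrite -[X in P X]setIT -integral_indic//.
  rewrite -ge0_integralZl//=; last exact/measurable_EFinP/measurable_indic.
  apply: ge0_le_integral => //=.
  - by apply/measurable_EFinP; apply: measurable_funM => //; exact: measurable_indic.
  - apply/measurable_EFinP; apply: measurable_funD; apply: measurable_funM => //.
    + exact/measurable_indic/measurableC.
    + exact: measurable_expR_psum.
  - by move=> w _; rewrite lee_fin lerDr mulr_ge0// expR_ge0.
rewrite expRB -[P _]fineK ?fin_num_measure// -EFinM !lee_fin.
by rewrite ler_pdivlMr ?expR_gt0// mulrC.
Qed.

(* A conditional Paley--Zygmund bound: with [Z = expR (l * psum a n)],
   [m = E Z] and [E Z ^ 2 = m ^ 4], integrate over [E] the pointwise bound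
   [Z <= m / 2 + Z ^ 2 / (4 m ^ 3) + m ^ 3 1_(Z >= m / e)]. *)
Lemma conditional_lower_tail E a n l : past a E ->
  (P E * (expR (- (l ^+ 2 * pvar a n)) / 4)%:E <=
   P (E `&` [set w | l ^+ 2 * pvar a n / 2 - 1 <= l * psum a n w]%R))%E.
Proof.
move=> aE; set V := l ^+ 2 * pvar a n; set G := [set w | _ <= _].
have mE : measurable E := past_measurable aE.
have mG : measurable G by exact: past_measurable (past_superlevel _ _ (leqnn (a + n))).
pose m := expR (V / 2).
have m0 : 0 < m by exact: expR_gt0.
have mP := mgf_past n l aE.
have mP2 := mgf_past n (2 * l) aE.
pose Z := fun w => expR (l * psum a n w).
have mZ : measurable_fun setT Z by exact: measurable_expR_psum.
have ZZ w : expR (2 * l * psum a n w) = Z w ^+ 2.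
  by rewrite /Z -expRM_natl mulrA.
have m4 : expR ((2 * l) ^+ 2 * pvar a n / 2) = m ^+ 4.
  by rewrite /m -expRM_natl /V; congr expR; field.
have key : (\int[P]_w (\1_E w * Z w)%:E <=
    \int[P]_w (m / 2 * \1_E w)%:E + \int[P]_w ((4 * m ^+ 3)^-1 * (\1_E w * Z w ^+ 2))%:E +
    \int[P]_w (m ^+ 3 * \1_(E `&` G) w)%:E)%E.
  have m1 : measurable_fun setT (fun w => (m / 2 * \1_E w)%:E).
    by apply/measurable_EFinP; apply: measurable_funM => //; exact: measurable_indic.
  have m2 : measurable_fun setT (fun w => ((4 * m ^+ 3)^-1 * (\1_E w * Z w ^+ 2))%:E).
    apply/measurable_EFinP; apply: measurable_funM => //.
    by apply: measurable_funM; [exact: measurable_indic|exact: measurable_funX].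
  have m3 : measurable_fun setT (fun w => (m ^+ 3 * \1_(E `&` G) w)%:E).
    apply/measurable_EFinP; apply: measurable_funM => //.
    by apply: measurable_indic; exact: measurableI.
  have p1 w : 0 <= m / 2 * \1_E w by rewrite mulr_ge0// divr_ge0// ltW.
  have p2 w : 0 <= (4 * m ^+ 3)^-1 * (\1_E w * Z w ^+ 2).
    by rewrite mulr_ge0// ?invr_ge0 ?mulr_ge0// ?exprn_ge0// ?(ltW m0)// expR_ge0.
  have p3 w : 0 <= m ^+ 3 * \1_(E `&` G) w.
    by rewrite mulr_ge0// exprn_ge0// ltW.
  rewrite -ge0_integralD//; last 2 first.
  - by move=> w _; rewrite lee_fin.
  - by move=> w _; rewrite lee_fin.
  rewrite -ge0_integralD//; last 3 first.
  - by move=> w _; rewrite -EFinD lee_fin addr_ge0.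
  - exact: emeasurable_funD.
  - by move=> w _; rewrite lee_fin.
  apply: ge0_le_integral => //.
  - by move=> w _; rewrite lee_fin mulr_ge0// expR_ge0.
  - apply/measurable_EFinP; apply: measurable_funM => //; exact: measurable_indic.
  - by apply: emeasurable_funD => //; exact: emeasurable_funD.
  move=> w _; rewrite -!EFinD lee_fin !indicE in_setI.
  case: (w \in E) => /=; last by rewrite !mul0r !mulr0 !addr0.
  rewrite !mul1r !mulr1; have Z0 : 0 < Z w := expR_gt0 _.
  case: (boolP (w \in G)) => /= wG.
    rewrite mulr1; set z := Z w in Z0 *.
    (* On [G], completing the square gives z <= z^2/(4 m^3) + m^3. *)
    have : 0 <= (z - 2 * m ^+ 3) ^+ 2 / (4 * m ^+ 3).
      by rewrite divr_ge0 ?sqr_ge0// mulr_ge0// exprn_ge0// ltW.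
    have -> : (z - 2 * m ^+ 3) ^+ 2 / (4 * m ^+ 3) = (4 * m ^+ 3)^-1 * z ^+ 2 - z + m ^+ 3.
      by field; rewrite gt_eqF.
    have : 0 <= m / 2 by rewrite divr_ge0// ltW.
    lra.
  rewrite mulr0 addr0.
  (* Off [G] the exponent is below V/2 - 1, so Z is below m exp(-1), hence below m/2. *)
  have : Z w <= m / 2.
    move: wG; rewrite notin_setE/= => /negP; rewrite -ltNge => Zm.
    apply: (@le_trans _ _ (m * expR (- 1))).
      by rewrite /m -expRD ler_expR ltW.
    rewrite ler_pM2l// expRN lef_pV2 ?posrE ?expR_gt0//.
    exact: le_trans (expR_ge1Dx _).
  have : 0 <= (4 * m ^+ 3)^-1 * Z w ^+ 2.
    by rewrite mulr_ge0 ?sqr_ge0// invr_ge0 mulr_ge0// exprn_ge0// ltW.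
  lra.
have mEG : measurable (E `&` G) by exact: measurableI.
have I1 : (\int[P]_w (m / 2 * \1_E w)%:E = (m / 2)%:E * P E)%E.
  under eq_integral do rewrite EFinM.
  rewrite ge0_integralZl//=; last 2 first.
  - by apply/measurable_EFinP; exact: measurable_indic.
  - by rewrite lee_fin divr_ge0// ltW.
  by rewrite integral_indic// setIT.
have I2 : (\int[P]_w ((4 * m ^+ 3)^-1 * (\1_E w * Z w ^+ 2))%:E =
    (4 * m ^+ 3)^-1%:E * (P E * (m ^+ 4)%:E))%E.
  under eq_integral do rewrite EFinM.
  rewrite ge0_integralZl//=; last 3 first.
  - by apply/measurable_EFinP; apply: measurable_funM; [exact: measurable_indic|exact: measurable_funX].
  - by move=> w _; rewrite lee_fin mulr_ge0// sqr_ge0.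
  - by rewrite lee_fin invr_ge0 mulr_ge0// exprn_ge0// ltW.
  by under eq_integral do rewrite -ZZ; rewrite mP2 m4.
have I3 : (\int[P]_w (m ^+ 3 * \1_(E `&` G) w)%:E = (m ^+ 3)%:E * P (E `&` G))%E.
  under eq_integral do rewrite EFinM.
  rewrite ge0_integralZl//=; last 2 first.
  - by apply/measurable_EFinP; exact: measurable_indic.
  - by rewrite lee_fin exprn_ge0// ltW.
  by rewrite integral_indic// setIT.
move: key; rewrite mP I1 I2 I3.
rewrite -(fineK (fin_num_measure P E mE)) -(fineK (fin_num_measure P _ mEG)).
(* The inequality reads p m <= p m/2 + p m/4 + m^3 q, so q >= p/(4 m^2), where m^2 = exp(V). *)
set p := fine _; set q := fine _; rewrite -!EFinM -!EFinD !lee_fin => key.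
have -> : expR (- V) = (m ^+ 2)^-1.
  by rewrite -expRM_natl expRN; congr (expR _)^-1; field.
have -> : p * ((m ^+ 2)^-1 / 4) = (p * m / 4) / m ^+ 3 by field; rewrite gt_eqF.
rewrite ler_pdivrMr ?exprn_gt0// mulrC.
have e : (4 * m ^+ 3)^-1 * (p * m ^+ 4) = p * m / 4 by field; rewrite gt_eqF.
move: key; rewrite e -/V -/m; lra.
Qed.

Definition calm (N : nat -> nat) (l y : nat -> R) K M : set T :=
  [set w | forall k, (K <= k < K + M)%N ->
    l k * psum (N k) (N k.+1 - N k) w < y k].

Lemma calmS N l y K M : calm N l y K M.+1 = calm N l y K M `&`
  ~` [set w | y (K + M)%N <= l (K + M)%N * psum (N (K + M)%N) (N (K + M).+1 - N (K + M)%N) w].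
Proof.
apply/seteqP; split => w /=.
  move=> H; split.
    by move=> k /andP[Kk kM]; apply: H; rewrite Kk addnS leqW.
  by apply/negP; rewrite -ltNge; apply: H; rewrite leq_addr addnS ltnSn.
move=> [H /negP]; rewrite -ltNge => HM k /andP[Kk].
by rewrite addnS ltnS leq_eqVlt => /predU1P[->//|kM]; apply: H; rewrite Kk.
Qed.

Lemma past_calm N l y K M : {homo N : i j / (i <= j)%N} ->
  past (N (K + M)%N) (calm N l y K M).
Proof.
move=> Nmono; elim: M => [|M IH].
  rewrite (_ : calm N l y K 0 = setT).
    exact: (@measurableT _ (g_sigma_algebraType (rectangle _))).
  apply/seteqP; split => // w _ k; rewrite addn0 => /andP[Kk].
  by rewrite ltnNge Kk.
rewrite calmS; apply: (@measurableI _ (g_sigma_algebraType (rectangle _))).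
  by apply: past_mono IH; apply: Nmono; rewrite addnS.
apply: (@measurableC _ (g_sigma_algebraType (rectangle _))).
by apply: past_superlevel; rewrite subnKC ?addnS//; exact: Nmono.
Qed.

(** Induction on the number of blocks: on the event, belonging to the past, that the earlier ones
    are calm, [conditional_lower_tail] lets block k reach its level with conditional probability at
    least [q k]. The alternative [q k = 0] covers blocks without variance. *)
Lemma calm_probability N (l y q : nat -> R) K M : {homo N : i j / (i <= j)%N} ->
  (forall k, (K <= k < K + M)%N -> 0 <= q k /\
    (q k = 0 \/ let V := l k ^+ 2 * pvar (N k) (N k.+1 - N k) in
      q k <= expR (- V) / 4 /\ y k <= V / 2 - 1)) ->
  (P (calm N l y K M) <= (\prod_(K <= k < K + M) (1 - q k))%:E)%E.
Proof.
move=> Nmono; elim: M => [|M IH] H.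
  rewrite [in X in (_ <= X)%E]addn0 big_geq//; apply: probability_le1.
  exact: past_measurable (@past_calm N l y K 0 Nmono).
rewrite calmS addnS big_nat_recr/= ?leq_addr//.
set k := (K + M)%N; set G := [set w | _].
set E := calm N l y K M.
have pE : past (N k) E by exact: past_calm.
have mE := past_measurable pE.
have mG : measurable G.
  apply: (@past_measurable (N k.+1)); apply: past_superlevel.
  by rewrite subnKC//; exact: Nmono.
have PE : (P E <= (\prod_(K <= k < K + M) (1 - q k))%:E)%E.
  by apply: IH => i /andP[Ki iM]; apply: H; rewrite Ki addnS leqW.
have [q0 qk] : 0 <= q k /\ (q k = 0 \/ let V := l k ^+ 2 * pvar (N k) (N k.+1 - N k) in
      q k <= expR (- V) / 4 /\ y k <= V / 2 - 1).
  by apply: H; rewrite leq_addr addnS ltnSn.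
have q1 : 0 <= 1 - q k.
  rewrite subr_ge0; case: qk => [->//|[qV _]]; apply: (le_trans qV).
  rewrite ler_pdivrMr// mul1r (@le_trans _ _ 1)//; last by rewrite ler1n.
  rewrite expR_le1 oppr_le0 mulr_ge0 ?sqr_ge0//; exact: pvar_ge0.
apply: (@le_trans _ _ (P E * (1 - q k)%:E)%E); last first.
  by rewrite EFinM; apply: lee_wpmul2r.
have {qk} qG : (P E * (q k)%:E <= P (E `&` G))%E.
  case: qk => [->|[qV yV]]; first by rewrite mule0.
  apply: (@le_trans _ _ (P E * (expR (- (l k ^+ 2 * pvar (N k) (N k.+1 - N k))) / 4)%:E)%E).
    by apply: lee_wpmul2l; rewrite ?lee_fin.
  apply: le_trans (conditional_lower_tail _ _ pE) _.
  apply: le_measure; rewrite ?inE; [|exact: measurableI|].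
    apply: measurableI => //; apply: (@past_measurable (N k.+1)).
    by apply: past_superlevel; rewrite subnKC//; exact: Nmono.
  by apply: setIS => w /=; exact: le_trans.
have PEG : (P E = P (E `&` ~` G) + P (E `&` G))%E by rewrite -setDE; exact: measureDI.
have f1 : P E \is a fin_num by exact: fin_num_measure.
have f2 : P (E `&` G) \is a fin_num by apply: fin_num_measure; exact: measurableI.
have f3 : P (E `&` ~` G) \is a fin_num.
  by apply: fin_num_measure; apply: measurableI => //; exact: measurableC.
move: PEG qG; move/EFin_fin_numP: f1 => [p ->]; move/EFin_fin_numP: f2 => [p' ->].
move/EFin_fin_numP: f3 => [p'' ->]; rewrite -!EFinM -EFinD => -[->].
rewrite !lee_fin; lra.
Qed.

End independent_sequence.

(** * Integration against a density and the Gaussian exponential moment *)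

Section density.
Context d (T : measurableType d) (R : realType).
Variables (mu nu : {measure set T -> \bar R}) (g : T -> R).
Hypotheses (mg : measurable_fun setT g) (g0 : forall x, 0 <= g x).
Hypothesis nuE : forall A, measurable A -> (nu A = \int[mu]_(x in A) (g x)%:E)%E.
Local Open Scope ereal_scope.
Import HBNNSimple.

Let integral_density_nnsfun (f : {nnsfun T >-> R}) :
  \int[nu]_x (f x)%:E = \int[mu]_x ((f x)%:E * (g x)%:E).
Proof.
have meg : measurable_fun setT (fun x => (g x)%:E) by exact/measurable_EFinP.
under [LHS]eq_integral do rewrite fimfunE -fsumEFin//.
rewrite [LHS]ge0_integral_fsum//; last 2 first.
  - by move=> r; exact/measurable_EFinP/measurableT_comp.
  - by move=> n x _; rewrite EFinM nnfun_muleindic_ge0.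
under [RHS]eq_integral.
  move=> x xD; rewrite fimfunE -fsumEFin// ge0_mule_fsuml; last first.
    by move=> r; rewrite EFinM nnfun_muleindic_ge0.
  over.
rewrite [RHS]ge0_integral_fsum//; last 2 first.
  - move=> r; apply: emeasurable_funM => //.
    by apply/measurable_EFinP; apply/measurableT_comp.
  - move=> n x _; apply: mule_ge0; last by rewrite lee_fin.
    by rewrite EFinM nnfun_muleindic_ge0.
apply: eq_fsbigr => r _.
rewrite integralZl_indic_nnsfun//= integral_indic// setIT nuE//.
have [r0|r0] := ltP r 0%R.
  rewrite preimage_nnfun0// integral_set0 mule0.
  rewrite integral0_eq// => x _; rewrite indicE in_set0 mulr0 mul0e//.
rewrite -ge0_integralZl//; last 2 first.
  - exact: measurable_funTS.
  - by move=> x _; rewrite lee_fin.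
rewrite integral_mkcond; apply: eq_integral => x _.
rewrite patchE indicE; case: ifPn => _; first by rewrite mulr1.
by rewrite mulr0 mul0e.
Qed.

(** Simple functions first, then monotone convergence on both sides along the same sequence. It
    turns an integral against the normal law, known on sets through its density, into a Lebesgue
    integral. *)
Lemma ge0_integral_density (f : T -> \bar R) :
  measurable_fun setT f -> (forall x, 0 <= f x) ->
  \int[nu]_x f x = \int[mu]_x (f x * (g x)%:E).
Proof.
move=> mf f0; pose f_ := nnsfun_approx measurableT mf.
have meg : measurable_fun setT (fun x => (g x)%:E) by exact/measurable_EFinP.
transitivity (lim (\int[nu]_x (f_ n x)%:E @[n --> \oo])).
  rewrite -monotone_convergence//=.
  - apply: eq_integral => x _; apply/esym/cvg_lim => //=.
    exact: cvg_nnsfun_approx.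
  - by move=> n; exact/measurable_EFinP/measurable_funTS.
  - by move=> n x _; rewrite lee_fin.
  - by move=> x _ m n mn; rewrite lee_fin; exact/lefP/nd_nnsfun_approx.
transitivity (lim (\int[mu]_x ((f_ n x)%:E * (g x)%:E) @[n --> \oo])).
  by apply: congr_lim; apply/funext => n /=; exact: integral_density_nnsfun.
rewrite -monotone_convergence//=.
- apply: eq_integral => x _; apply/cvg_lim => //=.
  apply: cvgeZr => //; exact: cvg_nnsfun_approx.
- by move=> n; apply: emeasurable_funM => //; exact/measurable_EFinP/measurable_funTS.
- by move=> n x _; rewrite mule_ge0 ?lee_fin.
- move=> x _ m n mn; apply: lee_wpmul2r; rewrite lee_fin//.
  exact/lefP/nd_nnsfun_approx.
Qed.

End density.

Section normal_mgf.
Context d (T : measurableType d) (R : realType) (P : probability T R).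

(** Completing the square: tilting the centred density by e^(l x) gives e^(l^2 s^2/2) times the
    normal density with mean l s^2, whose integral is 1. *)
Lemma normal_mgf (W : T -> R) (s l : R) : measurable_fun setT W -> s != 0 ->
  (forall A : set R, measurable A -> P (W @^-1` A) = normal_prob 0 s A) ->
  (\int[P]_w (expR (l * W w))%:E = (expR (l ^+ 2 * s ^+ 2 / 2))%:E)%E.
Proof.
move=> mW s0 WE.
have mW' : @measurable_fun _ _ T (measurableTypeR R) setT W := mW.
pose X : {mfun T >-> measurableTypeR R} := @mfun_Sub _ _ T (measurableTypeR R) W (mem_set mW').
have mexp : measurable_fun setT (fun x : measurableTypeR R => (expR (l * x))%:E).
  apply/measurable_EFinP; apply: (measurableT_comp (@measurable_expR R)).
  exact: measurable_funM.
have -> : (\int[P]_w (expR (l * W w))%:E = \int[distribution P X]_x (expR (l * x))%:E)%E.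
  by rewrite ge0_integral_pushforward.
have exp0 x : (0 <= (expR (l * x))%:E)%E by rewrite lee_fin expR_ge0.
rewrite (@ge0_integral_density _ _ _ (@lebesgue_measure R) (distribution P X)
  (normal_pdf 0 s) (measurable_normal_pdf 0 s) (normal_pdf_ge0 0 s) WE _ mexp exp0).
pose m := l * s ^+ 2.
transitivity (\int[lebesgue_measure]_x ((expR (l ^+ 2 * s ^+ 2 / 2))%:E * (normal_pdf m s x)%:E))%E.
  apply: eq_integral => x _; rewrite -!EFinM; congr (_%:E).
  rewrite /normal_pdf (negbTE s0) mulrCA [RHS]mulrCA; congr (_ * _).
  rewrite /normal_fun -!expRD; congr expR; rewrite /m; field.
  by [].
rewrite ge0_integralZl//=.
- by rewrite integral_normal_pdf mule1.
- by apply/measurable_EFinP; exact: measurable_normal_pdf.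
- by move=> x _; rewrite lee_fin normal_pdf_ge0.
Qed.

End normal_mgf.

(** * Dyadic approximation of the stochastic integral *)

Section uniform_continuity.
Context (R : realType).

Lemma half_cont_uniform (x : R -> R) (b e : R) : half_cont x -> 0 < e ->
  exists2 n, 0 < n & forall s t, 0 <= s <= b -> 0 <= t <= b -> `|s - t| < n ->
    `|x s - x t| < e.
Proof.
move=> /half_contP cx e0.
have /compact_near_coveringP cov := @segment_compact R 0 b.
pose Q (n : R) (t : R) := forall s, 0 <= s <= b -> 0 <= t <= b -> `|s - t| < n -> `|x s - x t| < e.
have : \forall n \near 0^'+, `[0, b] `<=` Q n.
  apply: cov => t; rewrite /= in_itv/= => /andP[t0 tb].
  have e2 : 0 < e / 2 by rewrite divr_gt0.
  have [n n0 Hn] := cx t t0 _ e2.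
  exists ([set u | `|u - t| < n / 2], [set m | m < n / 2]) => /=.
    split.
      apply/nbhs_ballP; exists (n / 2) => /=; first by rewrite divr_gt0.
      by move=> u; rewrite /ball/= distrC.
    by apply: nbhs_right_lt; rewrite divr_gt0.
  move=> [u m] /= [ut mn] s /andP[s0 sb] /andP[u0 ub] sum.
  have h1 := Hn u u0 ltac:(lra).
  have h2 : `|x s - x t| < e / 2.
    apply: Hn => //; rewrite -(subrK u s) -addrA (le_lt_trans (ler_normD _ _))//; lra.
  rewrite -(subrK (x t) (x s)) -addrA (le_lt_trans (ler_normD _ _))//.
  rewrite (distrC (x t)); lra.
move=> H; have [n [Qn n0]] := @filter_ex _ _ (at_right_proper_filter 0) _ (filterI H (nbhs_right_gt (0 : R))).
exists n => // s t s0b t0b st; by apply: Qn.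
Qed.

End uniform_continuity.

Lemma cvge0P (R : realType) (u : nat -> \bar R) : (forall n, 0 <= u n)%E ->
  u @ \oo --> (0 : \bar R)%E <->
  forall e : R, 0 < e -> exists n0, forall n, (n0 <= n)%N -> (u n <= e%:E)%E.
Proof.
move=> u0; split=> [cu e e0|H].
  have /cu : nbhs (0 : \bar R)%E [set x | (x < e%:E)%E].
    apply: open_nbhs_nbhs; split; first exact: open_ereal_lt_ereal.
    by rewrite /= lte_fin.
  by move=> [n0 _ Hn]; exists n0 => n nn; exact/ltW/Hn.
have fin_u : \forall n \near \oo, u n \is a fin_num.
  have [n0 Hn] := H 1 ltr01; exists n0 => // n /= /Hn un.
  by rewrite ge0_fin_numE// (le_lt_trans un)// ltry.
apply/fine_cvgP; split => //; apply/cvgrPdist_le => e e0.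
have [n0 Hn] := H e e0; exists n0 => // n /= /Hn un.
rewrite sub0r normrN ger0_norm ?fine_ge0// -lee_fin fineK//.
by rewrite ge0_fin_numE// (le_lt_trans un)// ltry.
Qed.

Lemma eventually_forall (n : nat) (Q : nat -> nat -> Prop) :
  (forall k, (k < n)%N -> exists m0, forall m, (m0 <= m)%N -> Q k m) ->
  exists m0, forall m, (m0 <= m)%N -> forall k, (k < n)%N -> Q k m.
Proof.
elim: n => [|n IH] H; first by exists 0%N.
have [m1 H1] := IH (fun k kn => H k (leqW kn)); have [m2 H2] := H n (ltnSn n).
exists (maxn m1 m2) => m; rewrite geq_max => /andP[m1m m2m] k.
by rewrite ltnS leq_eqVlt => /predU1P[->|kn]; [exact: H2|exact: H1].
Qed.

Lemma union_bound d (T : measurableType d) (R : realType) (P : probability T R)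
    (A E : set T) (D : nat -> set T) (N : nat) (z : R) :
  measurable A -> measurable E -> (forall j, measurable (D j)) ->
  A `<=` E `|` [set w | exists2 j, (j < N)%N & D j w] ->
  (forall j, (j < N)%N -> (P (D j) <= z%:E)%E) ->
  (P A <= P E + (N%:R * z)%:E)%E.
Proof.
move=> mA mE mD AED Dz.
have mU : measurable (\big[setU/set0]_(j < N) D j) by exact: bigsetU_measurable.
apply: (@le_trans _ _ (P (E `|` \big[setU/set0]_(j < N) D j))).
  apply: le_measure; rewrite ?inE//; first exact: measurableU.
  by apply: subset_trans AED _; apply: setUS => w /= [j jN Dj]; rewrite -bigcup_mkord; exists j.
apply: (le_trans (measureU2 _ mE mU)); apply: leeD2l.
apply: le_trans (Boole_inequality P (fun i _ => mD i)) _.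
apply: (@le_trans _ _ (\sum_(i < N) z%:E)%E); first by apply: lee_sum => i _; exact: Dz.
by rewrite sumEFin lee_fin sumr_const card_ord mulr_natl.
Qed.

Section dyadic_grid.
Context d (T : measurableType d) (R : realType) (P : probability T R).
Variables (F : R -> set (set T)) (B : R -> T -> R) (sigma : R -> R) (I : R -> T -> R).
Hypotheses (hF : complete_filtration P F) (hB : brownian_motion P B) (hBF : adapted F B).
Hypothesis hsigma : half_cont sigma.
Hypothesis hI : is_stochastic_integral P F sigma B I.
Local Notation mu := lebesgue_measure.

Definition mesh (m : nat) : R := (2 ^+ m)^-1.
Definition grid (m j : nat) : R := j%:R * mesh m.

Lemma mesh_gt0 m : 0 < mesh m.
Proof. by rewrite invr_gt0 exprn_gt0. Qed.

Lemma grid_ge0 m j : 0 <= grid m j.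
Proof. by rewrite mulr_ge0// ltW// mesh_gt0. Qed.

Lemma gridS m j : grid m j.+1 = grid m j + mesh m.
Proof. by rewrite /grid -natr1 mulrDl mul1r. Qed.

Lemma grid_le m i j : (i <= j)%N -> grid m i <= grid m j.
Proof. by move=> ij; rewrite ler_pM2r ?mesh_gt0// ler_nat. Qed.

(** The reason for dyadic grids: a point of level m stays a grid point at all finer levels, so sums
    with fixed end points can be refined indefinitely. *)
Lemma grid_refine m n j : grid (m + n) (j * 2 ^ n) = grid m j.
Proof.
have n0 : 2 ^+ n != 0 :> R by rewrite expf_neq0.
have m0 : 2 ^+ m != 0 :> R by rewrite expf_neq0.
rewrite /grid /mesh natrM natrX exprD; field.
by rewrite m0 n0.
Qed.

Lemma mesh_cvg (e : R) : 0 < e -> exists m0, forall m, (m0 <= m)%N -> mesh m < e.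
Proof.
move=> e0; exists (Num.truncn e^-1).+1 => m mm.
rewrite /mesh invf_plt ?posrE ?exprn_gt0//.
apply: lt_le_trans (truncnS_gt _) _; rewrite -natrX ler_nat.
exact: leq_trans mm (ltnW (ltn_expl _ _)).
Qed.

Lemma process_measurable X t : adapted F X -> 0 <= t -> measurable_fun setT (X t).
Proof.
by move=> aX t0 _ A mA; rewrite setTI; case: hF => _ _ FM _ _; apply: (FM t) => //; exact: aX.
Qed.

Definition dB m j w : R := B (grid m j.+1) w - B (grid m j) w.

Lemma measurable_dB m j : measurable_fun setT (dB m j).
Proof.
by apply: measurable_funB; apply: process_measurable => //; exact: grid_ge0.
Qed.

Lemma dB_independent m n (A : nat -> set R) : (forall i, measurable (A i)) ->
  (P (\bigcap_(i < n) dB m i @^-1` A i) = \prod_(i < n) P (dB m i @^-1` A i))%E.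
Proof.
move=> mA; case: hB => _ _ _ /(_ n (grid m) A); apply => //.
- exact: grid_ge0.
- by move=> i; exact: grid_le.
Qed.

Definition cell_var m j : R := sigma (grid m j) ^+ 2 * mesh m.

Lemma cell_var_ge0 m j : 0 <= cell_var m j.
Proof. by rewrite mulr_ge0 ?sqr_ge0// ltW// mesh_gt0. Qed.

Lemma dB_mgf m j l :
  (\int[P]_w (expR (l * (sigma (grid m j) * dB m j w)))%:E =
   (expR (l ^+ 2 * cell_var m j / 2))%:E)%E.
Proof.
under eq_integral do rewrite mulrA.
rewrite (@normal_mgf _ _ _ P (dB m j) (Num.sqrt (mesh m))).
- by rewrite sqr_sqrtr ?ltW ?mesh_gt0// /cell_var exprMn mulrA.
- exact: measurable_dB.
- by rewrite gt_eqF// sqrtr_gt0 mesh_gt0.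
move=> A mA; case: hB => _ _ /(_ (grid m j) (grid m j.+1)) + _.
rewrite gridS ltrDl mesh_gt0 grid_ge0 => /(_ isT isT A mA).
by rewrite /dB gridS [in Num.sqrt _]addrAC subrr add0r.
Qed.

Local Notation gsum m := (psum (dB m) (fun j => sigma (grid m j))).
Local Notation gvar m := (pvar (cell_var m)).

Definition step_integrand m k : elementary R :=
  [seq (sigma (grid m j), (grid m j, grid m j.+1)) | j <- iota 0 k].

Lemma step_integrand_in m k t : grid m k <= t -> elementary_in t (step_integrand m k).
Proof.
move=> kt; apply/allP => _ /mapP[j + ->]; rewrite mem_iota add0n => /= jk.
by rewrite grid_ge0 grid_le//= (le_trans _ kt)// grid_le.
Qed.

Lemma step_integralE m k w :
  elementary_integral B (step_integrand m k) w = gsum m 0 k w.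
Proof.
rewrite /elementary_integral /psum big_map add0n /index_iota subn0.
by apply: eq_bigr.
Qed.

Lemma step_funS m k x : elementary_fun (step_integrand m k.+1) x =
  elementary_fun (step_integrand m k) x +
  sigma (grid m k) * (grid m k < x <= grid m k.+1)%R%:R.
Proof.
by rewrite /elementary_fun /step_integrand -[X in iota 0 X]addn1 iotaD map_cat big_cat/= big_seq1 add0n.
Qed.

Lemma step_fun_eq0 m k x : grid m k < x -> elementary_fun (step_integrand m k) x = 0.
Proof.
elim: k => [|k IH] kx; first by rewrite /elementary_fun big_nil.
rewrite step_funS IH ?add0r; last by rewrite (le_lt_trans _ kx)// grid_le.
by rewrite (leNgt x) kx andbF mulr0.
Qed.

Lemma step_fun_close m k (e x : R) : 0 < x -> x <= grid m k ->
  (forall s, 0 <= s -> s < x -> x - s <= mesh m -> `|sigma s - sigma x| < e) ->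
  `|elementary_fun (step_integrand m k) x - sigma x| < e.
Proof.
move=> x0; elim: k => [|k IH] xk H.
  by move: xk; rewrite /grid mul0r leNgt x0.
rewrite step_funS; have [xk'|kx] := leP x (grid m k).
  by rewrite mulr0 addr0; exact: IH.
rewrite step_fun_eq0// add0r xk mulr1; apply: H => //; first exact: grid_ge0.
by move: xk; rewrite gridS lerBlDl.
Qed.

Lemma measurable_step_fun m k : measurable_fun setT (elementary_fun (step_integrand m k)).
Proof.
rewrite /elementary_fun; apply: measurable_sum => p.
apply: measurable_funM => //.
rewrite (_ : (fun x => _) = \1_(`]p.2.1, p.2.2])); first exact: measurable_indic.
apply/funext => x; rewrite indicE; congr (_%:R); congr nat_of_bool.
by apply/idP/idP; rewrite inE/= in_itv.
Qed.

Lemma step_L2 M K : let t := grid M K in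
  (fun n => \int[mu]_(x in `[0%R, t])
    ((elementary_fun (step_integrand (M + n) (K * 2 ^ n)) x - sigma x) ^+ 2)%R%:E)%E
  @ \oo --> (0 : \bar R)%E.
Proof.
move=> t; have t0 : 0 <= t := grid_ge0 _ _.
have msigma : measurable_fun `]0%R, t] sigma.
  apply: measurable_funS (measurable_itv `[0%R, t]) _ _; last first.
    apply: subspace_continuous_measurable_fun => //.
    exact: half_cont_itv.
  by move=> x /=; rewrite !in_itv/= => /andP[/ltW -> ->].
apply/cvge0P => [n|e e0].
  by apply: integral_ge0 => x _; rewrite lee_fin sqr_ge0.
(* The squared error is at most a^2 on a length t, and a^2 t <= 1 * (e/(t + 1)) * t <= e. *)
have a0 : 0 < Num.min 1 (e / (t + 1)) by rewrite lt_min ltr01 divr_gt0// ltr_wpDl.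
set a := Num.min _ _ in a0.
have [z z0 Hz] := half_cont_uniform t hsigma a0.
have [m0 Hm] := mesh_cvg z0.
exists m0 => n nm.
have mS := @measurable_step_fun (M + n) (K * 2 ^ n).
(* The cells are open on the left, so the step integrand vanishes at 0 whatever [sigma 0] is; this
   point is removed before the pointwise estimate. *)
rewrite -integral_itv_obnd_cbnd; last first.
  apply/measurable_EFinP; apply: measurable_funX; apply: measurable_funB => //.
  exact: measurable_funTS.
apply: (@le_trans _ _ (\int[mu]_(x in `]0%R, t]) (a ^+ 2)%:E)%E).
  apply: ge0_le_integral => //.
  - by move=> x _; rewrite lee_fin sqr_ge0.
  - apply/measurable_EFinP; apply: measurable_funX; apply: measurable_funB => //.
    exact: measurable_funTS.
  - move=> x; rewrite /= in_itv/= => /andP[x0 xt]; rewrite lee_fin.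
    have h : `|elementary_fun (step_integrand (M + n) (K * 2 ^ n)) x - sigma x| < a.
      apply: step_fun_close => //; first by rewrite grid_refine.
      move=> s s0 sx xs; apply: Hz; rewrite ?s0 ?(ltW x0)/= ?xt ?(ltW (lt_le_trans sx xt))//.
      rewrite distrC gtr0_norm ?subr_gt0// (le_lt_trans xs)//; apply: Hm.
      exact: leq_trans nm (leq_addl _ _).
    by rewrite -real_normK ?num_real// lerXn2r ?nnegrE ?(ltW h)// ltW.
rewrite integral_cst//= lebesgue_measure_itv/= lte_fin.
have a1 : a <= 1 by rewrite ge_min lexx.
have ae : a <= e / (t + 1) by rewrite ge_min lexx orbT.
case: ifPn => [t0'|_]; last by rewrite mule0 lee_fin ltW.
rewrite sube0 -EFinM lee_fin expr2 -mulrA.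
apply: (@le_trans _ _ (1 * (e / (t + 1) * (t + 1)))).
  apply: ler_pM => //; [exact: ltW|by rewrite mulr_ge0// ltW|].
  by apply: ler_pM => //; [exact: ltW|rewrite lerDl].
by rewrite mul1r divfK// gt_eqF// ltr_wpDl.
Qed.

Definition quadvar t : R := \int[mu]_(s in `[0, t]) (sigma s ^+ 2).

Let sigma2_cont : half_cont (fun s => sigma s ^+ 2).
Proof.
under eq_fun do rewrite expr2.
by move=> t; apply: continuousM; exact: hsigma.
Qed.

Lemma quadvar_increment : increment_bound quadvar (fun s => sigma s ^+ 2).
Proof.
by apply: (@primitive_increment_bound _ _ _ 0) => // t t0; rewrite add0r.
Qed.

Lemma quadvarN_increment : increment_bound (fun t => - quadvar t) (fun s => - sigma s ^+ 2).
Proof.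
apply: (@primitive_increment_bound _ _ _ 0); first exact: half_contN.
move=> t t0; rewrite add0r /quadvar; under [RHS]eq_Rintegral do rewrite -mulN1r.
by rewrite RintegralZl// ?mulN1r//; exact: half_cont_integrable.
Qed.

Lemma quadvar_le s t : 0 <= s -> s <= t -> quadvar s <= quadvar t.
Proof.
move=> s0 st; have := quadvarN_increment s0 st (c := 0); rewrite mul0r.
have /[swap]/[apply] : forall u, s <= u <= t -> - sigma u ^+ 2 <= 0.
  by move=> u _; rewrite oppr_le0 sqr_ge0.
lra.
Qed.

Lemma cell_var_close m j (a : R) :
  (forall u, grid m j <= u <= grid m j.+1 -> `|sigma u ^+ 2 - sigma (grid m j) ^+ 2| <= a) ->
  `|cell_var m j - (quadvar (grid m j.+1) - quadvar (grid m j))| <= a * mesh m.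
Proof.
move=> H; have jj : grid m j <= grid m j.+1 by exact: grid_le.
have gg : grid m j.+1 - grid m j = mesh m by rewrite gridS addrAC subrr add0r.
have := quadvar_increment (grid_ge0 m j) jj (c := sigma (grid m j) ^+ 2 + a).
have /[swap]/[apply] : forall u, grid m j <= u <= grid m j.+1 ->
    sigma u ^+ 2 <= sigma (grid m j) ^+ 2 + a.
  by move=> u /H; rewrite ler_norml => /andP[_]; lra.
have := quadvarN_increment (grid_ge0 m j) jj (c := - sigma (grid m j) ^+ 2 + a).
have /[swap]/[apply] : forall u, grid m j <= u <= grid m j.+1 ->
    - sigma u ^+ 2 <= - sigma (grid m j) ^+ 2 + a.
  by move=> u /H; rewrite ler_norml => /andP[+ _]; lra.
rewrite gg /cell_var ler_norml => h1 h2; apply/andP; split; lra.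
Qed.

Lemma gvar_cvg M K L (e : R) : 0 < e -> exists n0, forall n, (n0 <= n)%N ->
  `|gvar (M + n) (K * 2 ^ n) (L * 2 ^ n) - (quadvar (grid M (K + L)) - quadvar (grid M K))| <= e.
Proof.
move=> e0; set t := grid M (K + L).
have L0 : 0 < grid M L + 1 by rewrite ltr_wpDl// grid_ge0.
have [z z0 Hz] := half_cont_uniform t sigma2_cont (divr_gt0 e0 L0).
set a := e / _ in Hz.
have a0 : 0 < a by exact: divr_gt0.
have [n0 Hn] := mesh_cvg z0; exists n0 => n nn; set m := (M + n)%N.
have mz : mesh m < z by apply: Hn; exact: leq_trans nn (leq_addl _ _).
have close j : (j < (K + L) * 2 ^ n)%N ->
    `|cell_var m j - (quadvar (grid m j.+1) - quadvar (grid m j))| <= a * mesh m.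
  move=> jn; have jt : grid m j.+1 <= t by rewrite /t -(grid_refine M n) grid_le.
  apply: cell_var_close => u /andP[ju uj]; apply/ltW/Hz.
  - by rewrite (le_trans (grid_ge0 m j) ju) (le_trans uj).
  - by rewrite grid_ge0 (le_trans _ jt)// grid_le.
  - by rewrite ger0_norm ?subr_ge0// (le_lt_trans _ mz)// lerBlDl -gridS.
have sum_close k : (K * 2 ^ n + k <= (K + L) * 2 ^ n)%N ->
    `|gvar m (K * 2 ^ n) k - (quadvar (grid m (K * 2 ^ n + k)) - quadvar (grid m (K * 2 ^ n)))|
      <= a * (k%:R * mesh m).
  elim: k => [|k IH] kn.
    by rewrite /pvar !addn0 big_geq// subrr subr0 normr0 mul0r mulr0.
  have {}IH := IH (leq_trans (leq_add (leqnn _) (leqnSn k)) kn).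
  have := close (K * 2 ^ n + k)%N; rewrite -addnS => /(_ kn) c.
  rewrite pvarS; set g := gvar _ _ _ in IH *; set cv := cell_var _ _ in c *.
  move: IH c; rewrite !ler_norml -natr1 mulrDl mul1r mulrDr => /andP[? ?] /andP[? ?].
  by apply/andP; split; lra.
have := sum_close (L * 2 ^ n)%N; rewrite -mulnDl leqnn => /(_ isT).
rewrite -/(grid m _) !grid_refine => /le_trans; apply.
by rewrite /a mulrAC ler_pdivrMr// ler_pM2l// lerDl.
Qed.

Lemma I_measurable t : 0 <= t -> measurable_fun setT (I t).
Proof. by move=> t0; apply: process_measurable => //; case: hI. Qed.

Lemma gsum_measurable m a n : measurable_fun setT (gsum m a n).
Proof.
apply: (@past_fun_measurable _ _ _ (dB m) (measurable_dB m) (a + n)%N).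
exact: past_fun_psum.
Qed.

Definition deviation M K n (e : R) : set T :=
  [set w | e <= `|gsum (M + n) 0 (K * 2 ^ n) w - I (grid M K) w| ].

Lemma measurable_deviation M K n e : measurable (deviation M K n e).
Proof.
set Z := fun w => gsum (M + n) 0 (K * 2 ^ n) w - I (grid M K) w.
have mZ : measurable_fun setT (fun w => `|Z w|).
  apply: (measurableT_comp (@normr_measurable R setT)).
  by apply: measurable_funB; [exact: gsum_measurable|exact/I_measurable/grid_ge0].
have := mZ measurableT _ (measurable_itv `[e, +oo[); rewrite setTI.
suff -> : (fun w => `|Z w|) @^-1` `[e, +oo[ = deviation M K n e by [].
by apply/seteqP; split => w /=; rewrite in_itv/= andbT.
Qed.

(** Chebyshev's inequality for the L^2 convergence in [is_stochastic_integral], tested on the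
    left-point step integrands. *)
Lemma gsum_cvg M K (e z : R) : 0 < e -> 0 < z -> exists n0, forall n, (n0 <= n)%N ->
  (P (deviation M K n e) <= z%:E)%E.
Proof.
move=> e0 z0; set t := grid M K; have t0 : 0 <= t := grid_ge0 _ _.
case: hI => _ _ /(_ t t0 (fun n => step_integrand (M + n) (K * 2 ^ n))).
have h_in n : elementary_in t (step_integrand (M + n) (K * 2 ^ n)).
  by apply: step_integrand_in; rewrite grid_refine.
move=> /(_ h_in (@step_L2 M K)) H.
have int0 n : (0 <= \int[P]_w ((elementary_integral B
    (step_integrand (M + n) (K * 2 ^ n)) w - I t w) ^+ 2)%:E)%E.
  by apply: integral_ge0 => w _; rewrite lee_fin sqr_ge0.
have ze : 0 < z * e ^+ 2 by rewrite mulr_gt0// exprn_gt0.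
have [n0 Hn] := (cvge0P int0).1 H _ ze.
exists n0 => n /Hn; under eq_integral do rewrite step_integralE.
set Z := fun w => gsum (M + n) 0 (K * 2 ^ n) w - I t w => EZ.
have mZ : measurable_fun setT Z.
  by apply: measurable_funB; [exact: gsum_measurable|exact: I_measurable].
set A := deviation _ _ _ _; have mA : measurable A := @measurable_deviation M K n e.
have : ((e ^+ 2)%:E * P A <= (z * e ^+ 2)%:E)%E.
  apply: le_trans EZ; rewrite -[X in P X]setIT -integral_indic//.
  rewrite -ge0_integralZl//=; last 2 first.
  - exact/measurable_EFinP/measurable_indic.
  - by rewrite lee_fin sqr_ge0.
  apply: ge0_le_integral => //=.
  - by move=> w _; rewrite lee_fin mulr_ge0// sqr_ge0.
  - by apply/measurable_EFinP; apply: measurable_funM => //; exact: measurable_indic.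
  - by apply/measurable_EFinP; apply: measurable_funX.
  - move=> w _; rewrite lee_fin indicE; case: (boolP (w \in A)) => wA.
      rewrite mulr1 -(real_normK (num_real (Z w))) lerXn2r ?nnegrE ?(ltW e0)//.
      by move: wA; rewrite inE.
    by rewrite mulr0 sqr_ge0.
rewrite -(fineK (fin_num_measure P A mA)) -EFinM !lee_fin mulrC.
by rewrite ler_pM2r// exprn_gt0.
Qed.

Definition excursion M K L (s x : R) : set T :=
  [set w | exists2 j, (j <= L)%N & x < s * (I (grid M (K + j)) w - I (grid M K) w)].

Lemma measurable_superlevel (g : T -> R) x : measurable_fun setT g ->
  measurable [set w | x < g w].
Proof.
move=> mg; have := mg measurableT _ (measurable_itv `]x, +oo[); rewrite setTI.
suff -> : g @^-1` `]x, +oo[ = [set w | x < g w] by [].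
by apply/seteqP; split => w /=; rewrite in_itv/= andbT.
Qed.

Lemma measurable_I_increment M K K' (s : R) :
  measurable_fun setT (fun w => s * (I (grid M K) w - I (grid M K') w)).
Proof.
apply: measurable_funM => //.
by apply: measurable_funB; exact/I_measurable/grid_ge0.
Qed.

Lemma measurable_excursion M K L s x : measurable (excursion M K L s x).
Proof.
have -> : excursion M K L s x = \bigcup_(j in [set j | (j <= L)%N])
    [set w | x < s * (I (grid M (K + j)) w - I (grid M K) w)].
  by apply/seteqP; split => w /= [j jL H]; exists j.
apply: bigcup_measurable => j _.
exact/measurable_superlevel/measurable_I_increment.
Qed.

(** Passing to a fine grid costs x/4 at each end of an increment, so the Riemann sum must still
    reach x/2. With variance at most u the Chernoff exponent la^2 u/2 - la x/2 is minimal at la =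
    x/(2u), with value -x^2/(8u). The bound sees the grid only through u. *)
Lemma excursion_tail M K L (s x u : R) : `|s| = 1 -> 0 < x ->
  quadvar (grid M (K + L)) - quadvar (grid M K) < u ->
  (P (excursion M K L s x) <= (expR (- (x ^+ 2 / (8 * u))))%:E)%E.
Proof.
move=> s1 x0 Vu.
have u0 : 0 < u.
  apply: le_lt_trans Vu; rewrite subr_ge0 quadvar_le ?grid_ge0//.
  by rewrite grid_le// leq_addr.
have ss : s ^+ 2 = 1 by rewrite -real_normK ?num_real// s1 expr1n.
apply/lee_addgt0Pr => e e0.
(* The error is shared among L + 1 grid times, since the starting time j = 0 is approximated too. *)
pose z := e / L.+1%:R.
have z0 : 0 < z by rewrite divr_gt0// ltr0n.
have x4 : 0 < x / 4 by rewrite divr_gt0.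
have Vu0 : 0 < u - (quadvar (grid M (K + L)) - quadvar (grid M K)) by rewrite subr_gt0.
have [n1 H1] := gvar_cvg M K L Vu0.
have [n2 H2] : exists n0, forall n, (n0 <= n)%N -> forall j, (j < L.+1)%N ->
    (P (deviation M (K + j) n (x / 4)) <= z%:E)%E.
  by apply: eventually_forall => j _; exact: gsum_cvg.
pose n := maxn n1 n2; pose m := (M + n)%N; pose a := (K * 2 ^ n)%N.
have gu : gvar m a (L * 2 ^ n) <= u.
  by have := H1 n (leq_maxl _ _); rewrite ler_norml => /andP[_]; lra.
pose la := x / (2 * u); pose l := s * la; pose x' := la * (x / 2).
have l0 : 0 < la by rewrite divr_gt0// mulr_gt0.
pose E := passage (dB m) (fun j => sigma (grid m j)) a l x' (L * 2 ^ n).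
have mE : measurable E.
  apply: (@past_measurable _ _ _ (dB m) (measurable_dB m) (a + L * 2 ^ n)%N).
  exact: past_passage.
have PE : (P E <= (expR (- (x ^+ 2 / (8 * u))))%:E)%E.
  apply: (@le_trans _ _ (expR (l ^+ 2 * gvar m a (L * 2 ^ n) / 2 - x'))%:E).
    exact: (passage_probability (measurable_dB m) (@dB_independent m)
      (cell_var_ge0 m) (dB_mgf m)).
  rewrite lee_fin ler_expR /l /x' exprMn ss mul1r.
  have -> : - (x ^+ 2 / (8 * u)) = la ^+ 2 * u / 2 - la * (x / 2).
    by rewrite /la; field; rewrite gt_eqF.
  rewrite lerD2r ler_pM2r ?invr_gt0// ler_pM2l// exprn_gt0//.
have -> : e = L.+1%:R * z by rewrite /z mulrC divfK// pnatr_eq0.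
apply: le_trans (leeD2r _ PE).
apply: (union_bound (D := fun j => deviation M (K + j) n (x / 4))) => //.
- exact: measurable_excursion.
- by move=> j; exact: measurable_deviation.
- move=> w [j jL xj].
  have [dj|ndj] := pselect (deviation M (K + j) n (x / 4) w); first by right; exists j.
  have [d0|nd0] := pselect (deviation M (K + 0) n (x / 4) w); first by right; exists 0%N.
  left; exists (j * 2 ^ n)%N; first by rewrite leq_mul2r jL orbT.
  have -> : l * gsum m a (j * 2 ^ n) w = la * (s * gsum m a (j * 2 ^ n) w).
    by rewrite mulrA (mulrC la).
  rewrite ler_pM2l// psum_sub /a -mulnDl.
  move: ndj nd0; rewrite /deviation /= addn0 => /negP + /negP; rewrite -!ltNge.
  set g1 := gsum _ _ _ _; set g0 := gsum _ _ _ _; set I1 := I _ _ in xj *; set I0 := I _ _ in xj *.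
  move=> h1 h0.
  have : s * (g1 - I1) >= - `|g1 - I1|.
    by rewrite -[`|g1 - I1|]mul1r -s1 -normrM -lerN2 opprK (le_trans (ler_norm _))// normrN.
  have : s * (I0 - g0) >= - `|g0 - I0|.
    rewrite -[`|g0 - I0|]mul1r -s1 -normrM -lerN2 opprK (le_trans (ler_norm _))//.
    by rewrite normrN !normrM (distrC I0).
  lra.
- exact: H2 (leq_maxr _ _).
Qed.

Definition quiet (N : nat -> nat) (s : R) (y : nat -> R) K M : set T :=
  [set w | forall k, (K <= k < K + M)%N ->
     s * (I (grid 0 (N k.+1)) w - I (grid 0 (N k)) w) <= y k].

Lemma measurable_quiet N s y K M : measurable (quiet N s y K M).
Proof.
have -> : quiet N s y K M = \bigcap_(k in [set k | (K <= k < K + M)%N])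
    (~` [set w | y k < s * (I (grid 0 (N k.+1)) w - I (grid 0 (N k)) w)]).
  apply/seteqP; split => w /= H k /H /=; first by rewrite leNgt => /negP.
  by rewrite leNgt => /negP.
apply: bigcap_measurableType => k _.
apply: measurableC; exact/measurable_superlevel/measurable_I_increment.
Qed.

(** The strict inequalities concern the exact variance [V]. Their slack is split so that on all fine
    grids they survive with the Riemann variance and with a margin [p.2] on the level, reserved for
    the error between sums and integral. *)
Lemma block_parameters (N N' : nat) (y q : R) : (N <= N')%N ->
  let V := quadvar (grid 0 N') - quadvar (grid 0 N) in
  (exists2 l, 0 < l & y < l * V / 2 - l^-1 /\ q < expR (- (l ^+ 2 * V)) / 4) ->
  0 < q ->
  exists p : R * R, [/\ 0 < p.1, 0 < p.2 & exists n0, forall n, (n0 <= n)%N ->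
    let V' := p.1 ^+ 2 * gvar n (N * 2 ^ n) (N' * 2 ^ n - N * 2 ^ n) in
    q <= expR (- V') / 4 /\ p.1 * (y + p.2) <= V' / 2 - 1].
Proof.
move=> NN' V [l l0 [yl ql]] q0.
pose e := (l * V / 2 - l^-1 - y) / 2.
have e0 : 0 < e by rewrite divr_gt0// subr_gt0.
have q4 : 0 < 4 * q by rewrite mulr_gt0.
have lnq : ln (4 * q) < - (l ^+ 2 * V).
  rewrite -ltr_expR lnK ?posrE//.
  by move: ql; rewrite ltr_pdivlMr// mulrC.
have z0 : 0 < Num.min (2 * e / l) ((- (l ^+ 2 * V) - ln (4 * q)) / l ^+ 2).
  by rewrite lt_min !divr_gt0 ?exprn_gt0 ?mulr_gt0// subr_gt0.
have [n0 Hn] := gvar_cvg 0 N (N' - N) z0; set z := Num.min _ _ in z0 Hn.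
have z1 : z <= 2 * e / l by rewrite ge_min lexx.
have z2 : z <= (- (l ^+ 2 * V) - ln (4 * q)) / l ^+ 2 by rewrite ge_min lexx orbT.
exists (l, e); split => //=; exists n0 => n /Hn.
rewrite add0n subnKC// mulnBl -/V; set g := gvar _ _ _.
rewrite ler_norml => /andP[g1 g2]; split.
  rewrite ler_pdivlMr// mulrC -(@lnK _ (4 * q)) ?posrE// ler_expR.
  have : g - V <= (- (l ^+ 2 * V) - ln (4 * q)) / l ^+ 2 by exact: le_trans z2.
  rewrite ler_pdivlMr ?exprn_gt0//; lra.
have : V - g <= 2 * e / l by apply: le_trans z1; lra.
rewrite ler_pdivlMr// => h.
have -> : l ^+ 2 * g / 2 - 1 = l * (l * g / 2 - l^-1).
  by field; rewrite gt_eqF.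
rewrite ler_pM2l//; rewrite /e in h *; lra.
Qed.

(** [calm_probability] in the limit of fine grids: a quiet path is calm for the Riemann sums unless
    the sum at one end of a block misses the integral by half the margin. *)
Lemma quiet_probability N s (y q : nat -> R) K M : {homo N : i j / (i <= j)%N} ->
  `|s| = 1 -> (forall k, (K <= k < K + M)%N -> 0 <= q k /\ (0 < q k ->
    let V := quadvar (grid 0 (N k.+1)) - quadvar (grid 0 (N k)) in
    exists2 l, 0 < l & y k < l * V / 2 - l^-1 /\ q k < expR (- (l ^+ 2 * V)) / 4)) ->
  (P (quiet N s y K M) <= (\prod_(K <= k < K + M) (1 - q k))%:E)%E.
Proof.
move=> Nmono s1 Hq.
have ss : s ^+ 2 = 1 by rewrite -real_normK ?num_real// s1 expr1n.
pose good k (p : R * R) n :=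
  q k = 0 \/ let V' := p.1 ^+ 2 * gvar n (N k * 2 ^ n) (N k.+1 * 2 ^ n - N k * 2 ^ n) in
    q k <= expR (- V') / 4 /\ p.1 * (y k + p.2) <= V' / 2 - 1.
pose ok k (p : R * R) := [/\ 0 < p.1, 0 < p.2 &
    (K <= k < K + M)%N -> exists n0, forall n, (n0 <= n)%N -> good k p n].
have ok_ex k : exists p, ok k p.
  have [kKM|nk] := boolP (K <= k < K + M)%N; last by exists (1, 1); split => //; rewrite (negbTE nk).
  have [q0 Hk] := Hq k kKM; move: q0; rewrite le_eqVlt => /predU1P[q0|q0].
    by exists (1, 1); split => // _; exists 0%N => n _; left.
  have [p [p1 p2 [n0 Hn]]] := block_parameters (Nmono _ _ (leqnSn k)) (Hk q0) q0.
  by exists p; split => // _; exists n0 => n /Hn; right.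
have [p Hp] := choice ok_ex.
apply/lee_addgt0Pr => e e0.
(* Two end points for each of the [M] blocks; the extra unit keeps the divisor positive when [M] is
   0 and matches the empty event in [D]. *)
pose z := e / (M + M).+1%:R.
have z0 : 0 < z by rewrite divr_gt0// ltr0n.
have p2 k : 0 < (p k).2 / 2 by have [_ p2 _] := Hp k; rewrite divr_gt0.
have [n1 H1] : exists n0, forall n, (n0 <= n)%N -> forall i, (i < M)%N ->
    good (K + i)%N (p (K + i)%N) n.
  by apply: eventually_forall => i iM; have [_ _] := Hp (K + i)%N; apply; rewrite leq_addr ltn_add2l.
have [n2 H2] : exists n0, forall n, (n0 <= n)%N -> forall i, (i < M)%N ->
    (P (deviation 0 (N (K + i)%N) n ((p (K + i)%N).2 / 2)) <= z%:E)%E.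
  by apply: eventually_forall => i _; exact: gsum_cvg.
have [n3 H3] : exists n0, forall n, (n0 <= n)%N -> forall i, (i < M)%N ->
    (P (deviation 0 (N (K + i).+1) n ((p (K + i)%N).2 / 2)) <= z%:E)%E.
  by apply: eventually_forall => i _; exact: gsum_cvg.
pose n := maxn n1 (maxn n2 n3).
have n1n : (n1 <= n)%N by rewrite leq_maxl.
have n2n : (n2 <= n)%N by rewrite !leq_max leqnn orbT.
have n3n : (n3 <= n)%N by rewrite !leq_max leqnn !orbT.
pose N' k := (N k * 2 ^ n)%N.
have N'mono : {homo N' : i j / (i <= j)%N}.
  by move=> i j ij; rewrite leq_mul2r Nmono ?orbT.
pose E := calm (dB n) (fun j => sigma (grid n j)) N' (fun k => s * (p k).1)
  (fun k => (p k).1 * (y k + (p k).2)) K M.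
have PE : (P E <= (\prod_(K <= k < K + M) (1 - q k))%:E)%E.
  apply: (calm_probability (measurable_dB n) (@dB_independent n) (cell_var_ge0 n) (dB_mgf n)) => //.
  move=> k /[dup] kKM /andP[Kk kM]; split; first by have [] := Hq k kKM.
  have := H1 n n1n (k - K)%N; rewrite ltn_subLR// kM subnKC// => /(_ isT).
  by rewrite /good exprMn ss mul1r.
pose D j := if (j < M)%N then deviation 0 (N (K + j)%N) n ((p (K + j)%N).2 / 2)
  else if (j - M < M)%N
    then deviation 0 (N (K + (j - M)).+1) n ((p (K + (j - M))%N).2 / 2) else set0.
have -> : e = (M + M).+1%:R * z by rewrite /z mulrC divfK// pnatr_eq0.
apply: le_trans (leeD2r _ PE).
apply: (union_bound (D := D)).
- exact: measurable_quiet.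
- apply: (@past_measurable _ _ _ (dB n) (measurable_dB n) (N' (K + M)%N)).
  exact: past_calm.
- move=> j; rewrite /D; case: ifP => _; first exact: measurable_deviation.
  by case: ifP => _ //; exact: measurable_deviation.
- move=> w Qw; apply: contrapT => H.
  have nD j : (j < (M + M).+1)%N -> ~ D j w by move=> jM Dj; apply: H; right; exists j.
  apply: H; left => k /[dup] kKM /andP[Kk kM].
  have iM : (k - K < M)%N by rewrite ltn_subLR.
  have : ~ D (k - K)%N w by apply: nD; rewrite (ltn_trans iM)// ltnS leq_addr.
  have : ~ D (M + (k - K))%N w by apply: nD; rewrite ltnS ltnW// ltn_add2l.
  rewrite /D iM ltnNge leq_addr/= addKn iM subnKC// /deviation add0n/=.
  move=> /negP + /negP; rewrite -!ltNge.
  rewrite [gsum n (N' k) _ w]psum_sub subnKC ?N'mono//.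
  have := Qw k kKM; set I1 := I _ _; set I0 := I _ _.
  set g1 := gsum _ _ _ _; set g0 := gsum _ _ _ _ => sI h1 h0.
  have [p1 _ _] := Hp k.
  rewrite -mulrA mulrCA ltr_pM2l//.
  have : s * (g1 - I1) <= `|g1 - I1|.
    by rewrite (le_trans (ler_norm _))// normrM s1 mul1r.
  have : s * (I0 - g0) <= `|g0 - I0|.
    by rewrite (le_trans (ler_norm _))// normrM s1 mul1r distrC.
  lra.
- move=> j jM; rewrite /D; case: ltnP => jM'; first exact: H2.
  case: ltnP => jMM; first exact: H3.
  by rewrite measure0 lee_fin ltW.
Qed.

End dyadic_grid.

(** * Almost sure behaviour of the increments *)

Section almost_sure_increments.
Context d (T : measurableType d) (R : realType) (P : probability T R).
Variables (F : R -> set (set T)) (B : R -> T -> R) (sigma : R -> R) (I : R -> T -> R).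
Hypotheses (hF : complete_filtration P F) (hB : brownian_motion P B) (hBF : adapted F B).
Hypothesis hsigma : half_cont sigma.
Hypothesis hI : is_stochastic_integral P F sigma B I.
Local Notation mu := lebesgue_measure.
Local Notation V := (quadvar sigma).

Lemma grid0 n : grid R 0 n = n%:R.
Proof. by rewrite /grid /mesh expr0 invr1 mulr1. Qed.

Lemma thetaE n : theta sigma n ^+ 2 = V n.+1%:R - V n%:R.
Proof.
have s2 : half_cont (fun s => sigma s ^+ 2).
  by under eq_fun do rewrite expr2; move=> t; apply: continuousM; exact: hsigma.
rewrite /theta sqr_sqrtr; last by apply: Rintegral_ge0 => t _; exact: sqr_ge0.
by rewrite /quadvar Rintegral_itv_sub// ler_nat.
Qed.

Lemma theta_ge0 n : 0 <= theta sigma n.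
Proof. exact: sqrtr_ge0. Qed.

Lemma I_cont w : half_cont (fun t => I t w).
Proof. by case: hI => _ + _; apply. Qed.

Let tail M K L (s x u : R) : `|s| = 1 -> 0 < x -> V (grid R M (K + L)) - V (grid R M K) < u ->
  (P (excursion I M K L s x) <= (expR (- (x ^+ 2 / (8 * u))))%:E)%E.
Proof. exact: (excursion_tail hF hB hBF hsigma hI). Qed.

Let excursion_meas M K L s x : measurable (excursion I M K L s x).
Proof. exact: (measurable_excursion hF hI). Qed.

(** * Convergent case: oscillation of the integral on unit intervals *)

Definition swing M n x : set T :=
  excursion I M (n * 2 ^ M) (2 ^ M) 1 x `|` excursion I M (n * 2 ^ M) (2 ^ M) (- 1) x.

Definition big_swing n x : set T := \bigcup_M swing M n x.

Lemma measurable_swing M n x : measurable (swing M n x).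
Proof. exact: measurableU. Qed.

Lemma swing_mono n x : nondecreasing_seq (fun M => swing M n x).
Proof.
suff sub s M : excursion I M (n * 2 ^ M) (2 ^ M) s x `<=`
    excursion I M.+1 (n * 2 ^ M.+1) (2 ^ M.+1) s x.
  by apply/nondecreasing_seqP => M; apply/subsetPset; apply: setUSS; exact: sub.
move=> w [j jM H]; exists (j * 2)%N; first by rewrite expnSr leq_mul2r jM orbT.
rewrite expnSr mulnA -mulnDl -[M.+1]addn1 -{1 3}(expn1 2).
by rewrite (grid_refine R M 1 (n * 2 ^ M + j)) (grid_refine R M 1 (n * 2 ^ M)).
Qed.

(** The tail bound is the same at every level and the events increase with the level, so it passes
    to the union; the factor 2 accounts for the two signs. *)
Lemma big_swing_probability n (x u : R) : 0 < x -> theta sigma n ^+ 2 < u ->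
  (P (big_swing n x) <= (2 * expR (- (x ^+ 2 / (8 * u))))%:E)%E.
Proof.
move=> x0 tu.
have mb : measurable (big_swing n x) by apply: bigcupT_measurable => M; exact: measurable_swing.
have cv := nondecreasing_cvg_mu (mu := P) (fun M => measurable_swing M n x) mb (swing_mono n x).
have -> : P (big_swing n x) = limn (P \o (fun M => swing M n x)) by apply/esym/cvg_lim.
apply: lime_le; first by apply/cvg_ex; eexists; exact: cv.
apply: nearW => M /=; rewrite /swing.
apply: le_trans (measureU2 _ (excursion_meas _ _ _ _ _) (excursion_meas _ _ _ _ _)) _.
have Vu : V (grid R M (n * 2 ^ M + 2 ^ M)) - V (grid R M (n * 2 ^ M)) < u.
  rewrite -{2}(mul1n (2 ^ M)%N) -mulnDl addn1 !(grid_refine R 0 M) !grid0.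
  by rewrite -thetaE.
have -> : 2 * expR (- (x ^+ 2 / (8 * u))) = expR (- (x ^+ 2 / (8 * u))) + expR (- (x ^+ 2 / (8 * u))).
  by rewrite mulr_natl mulr2n.
by rewrite EFinD; apply: leeD; apply: tail; rewrite ?normrN ?normr1.
Qed.

(** The event controls dyadic times only. If the bound fails at t, then by continuity it fails at t
    rounded down to a fine enough grid. *)
Lemma small_swing n (x t : R) w : n%:R <= t <= n.+1%:R -> ~ big_swing n x w ->
  `|I t w - I n%:R w| <= x.
Proof.
move=> /andP[nt tn] nb; rewrite leNgt; apply/negP => xI.
have t0 : 0 <= t by exact: le_trans nt.
have e0 : 0 < `|I t w - I n%:R w| - x by rewrite subr_gt0.
have [z z0 Hz] := (half_contP _).1 (@I_cont w) t t0 _ e0.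
have [M HM] := mesh_cvg z0; have {HM} Mz := HM M (leqnn M).
have p2 : 0 < 2 ^+ M :> R by rewrite exprn_gt0.
have tn0 : 0 <= (t - n%:R) * 2 ^+ M by rewrite mulr_ge0 ?subr_ge0// ltW.
pose j := Num.truncn ((t - n%:R) * 2 ^+ M).
have /andP[jt tj] := truncn_itv tn0; rewrite -/j in jt tj.
have jM : (j <= 2 ^ M)%N.
  rewrite -(ler_nat R) natrX (le_trans jt)// ler_piMl ?(ltW p2)//.
  by rewrite lerBlDl natr1.
have gE : grid R M (n * 2 ^ M + j) = n%:R + j%:R * mesh R M.
  by rewrite /grid natrD mulrDl natrM natrX /mesh mulfK// gt_eqF.
have gn : grid R M (n * 2 ^ M) = n%:R by rewrite (grid_refine R 0 M) grid0.
have g_close : `|n%:R + j%:R * mesh R M - t| < z.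
  apply: le_lt_trans Mz; rewrite /mesh.
  move: jt tj; rewrite -ler_pdivrMr// -ltr_pdivlMr// -(natr1 j) mulrDl mul1r => jt tj.
  by rewrite ler_norml; apply/andP; split; lra.
have {g_close} := Hz _ _ g_close.
rewrite -gE grid_ge0 => /(_ isT) close.
apply: nb; exists M => //; rewrite /swing/=.
pose D := I (grid R M (n * 2 ^ M + j)) w - I n%:R w.
have D_gt : x < `|D|.
  have : `|I t w - I n%:R w| <= `|I t w - I (grid R M (n * 2 ^ M + j)) w| + `|D|.
    by apply: le_trans (ler_normD _ _); rewrite /D addrA subrK.
  rewrite (distrC (I t w) (I (grid R M (n * 2 ^ M + j)) w)); lra.
have [D0|D0] := leP 0 D; [left|right]; exists j => //; rewrite gn -/D.
  by rewrite mul1r -(ger0_norm D0).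
by rewrite mulN1r -(ltr0_norm D0).
Qed.

(** At u = 2 th^2 the tail is exp(-x^2/(16 th^2)), without the prefactor th of the summand. The gap
    k between the exponents pays for it: th e^(k/th^2) >= min(1, k), trivially for th >= 1 and by
    e^v >= v otherwise. *)
Lemma exp_weight (th eps x : R) : 0 < th -> 0 < eps -> eps ^+ 2 / 2 < x ^+ 2 / 16 ->
  expR (- (x ^+ 2 / (8 * (2 * th ^+ 2)))) <=
  (Num.min 1 (x ^+ 2 / 16 - eps ^+ 2 / 2))^-1 *
  (th * expR (- (eps ^+ 2 / 2 * (th ^+ 2)^-1))).
Proof.
move=> th0 eps0 ex; set k := x ^+ 2 / 16 - eps ^+ 2 / 2.
have k0 : 0 < k by rewrite subr_gt0.
have m0 : 0 < Num.min 1 k by rewrite lt_min ltr01.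
have th2 : 0 < th ^+ 2 by rewrite exprn_gt0.
rewrite ler_pdivlMl//.
have -> : - (eps ^+ 2 / 2 * (th ^+ 2)^-1) = k / th ^+ 2 + - (x ^+ 2 / (8 * (2 * th ^+ 2))).
  by rewrite /k; field; rewrite gt_eqF.
rewrite expRD (mulrA th) ler_pM2r ?expR_gt0//.
have [th1|th1] := leP 1 th.
  apply: (@le_trans _ _ (1 * 1)); first by rewrite mulr1 ge_min lexx.
  apply: ler_pM => //; apply: le_trans (expR_ge1Dx _).
  by rewrite lerDl divr_ge0// ltW.
apply: (@le_trans _ _ k); first by rewrite ge_min lexx orbT.
apply: (@le_trans _ _ (th * (k / th ^+ 2))).
  have -> : th * (k / th ^+ 2) = k / th by field; rewrite gt_eqF.
  by rewrite ler_pdivlMr// ler_piMr// ltW.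
rewrite ler_pM2l//; apply: le_trans (expR_ge1Dx _).
by rewrite lerDr.
Qed.

Lemma big_swing_bound n (x eps : R) : 0 < x -> 0 < eps -> eps ^+ 2 / 2 < x ^+ 2 / 16 ->
  (P (big_swing n x) <= (2 / Num.min 1 (x ^+ 2 / 16 - eps ^+ 2 / 2))%:E *
    (if theta sigma n == 0 then 0 else
     theta sigma n * expR (- (eps ^+ 2 / 2 * (theta sigma n ^+ 2)^-1)))%R%:E)%E.
Proof.
move=> x0 eps0 ex; have k0 : 0 < x ^+ 2 / 16 - eps ^+ 2 / 2 by rewrite subr_gt0.
have m0 : 0 < Num.min 1 (x ^+ 2 / 16 - eps ^+ 2 / 2) by rewrite lt_min ltr01.
have [th0|th_neq0] := eqVneq (theta sigma n) 0.
  rewrite mule0; apply/lee_addgt0Pr => e e0; rewrite add0e.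
  (* If theta vanishes, every u > 0 is admissible; this one gives the bound 2 exp(-2/e) <= e. *)
  have u0 : 0 < x ^+ 2 * e / 16 by rewrite divr_gt0// mulr_gt0// exprn_gt0.
  apply: le_trans (@big_swing_probability n x (x ^+ 2 * e / 16) x0 _) _.
    by rewrite th0 expr0n.
  rewrite lee_fin.
  have -> : x ^+ 2 / (8 * (x ^+ 2 * e / 16)) = 2 / e.
    by field; rewrite !gt_eqF.
  have e2 : 0 < 2 / e by rewrite divr_gt0.
  rewrite expRN -ler_pdivlMl// invf_ple ?posrE ?expR_gt0 ?mulr_gt0 ?invr_gt0//.
  rewrite invfM invrK; apply: le_trans (expR_ge1Dx _).
  by rewrite lerDr.
have th0 : 0 < theta sigma n by rewrite lt_neqAle eq_sym th_neq0 theta_ge0.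
have tu : theta sigma n ^+ 2 < 2 * theta sigma n ^+ 2.
  by rewrite ltr_pMl ?exprn_gt0// ltr1n.
apply: le_trans (big_swing_probability x0 tu) _.
by rewrite -EFinM lee_fin -[leRHS]mulrA ler_pM2l//; exact: exp_weight.
Qed.

Lemma swing_eventually_small (x eps : R) : 0 < x -> 0 < eps -> eps ^+ 2 / 2 < x ^+ 2 / 16 ->
  (Sprime sigma eps < +oo)%E ->
  {ae P, forall w, exists N : nat, forall (n : nat) t, (N <= n)%N ->
    n%:R <= t <= n.+1%:R -> `|I t w - I n%:R w| <= x}.
Proof.
move=> x0 eps0 ex S'oo.
have mb n : measurable (big_swing n x) by apply: bigcupT_measurable => M; exact: measurable_swing.
have P0 : P (lim_sup_set (big_swing ^~ x)) = 0%E.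
  apply: lim_sup_set_cvg0 => //.
  apply: (@le_lt_trans _ _ (\sum_(0 <= n <oo)
      ((2 / Num.min 1 (x ^+ 2 / 16 - eps ^+ 2 / 2))%:E *
      (if theta sigma n == 0 then 0 else
       theta sigma n * expR (- (eps ^+ 2 / 2 * (theta sigma n ^+ 2)^-1)))%R%:E))%E).
    apply: lee_nneseries => [n _ _|n _]; first exact: measure_ge0.
    exact: big_swing_bound.
  rewrite nneseriesZl; last first.
    by move=> n _; case: ifP => _; rewrite lee_fin// mulr_ge0 ?theta_ge0// expR_ge0.
  by rewrite lte_mul_pinfty// lee_fin divr_ge0// ltW// lt_min ltr01 subr_gt0.
exists (lim_sup_set (big_swing ^~ x)); split => //.
  by apply: bigcap_measurableType => n _; apply: bigcup_measurable => j _.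
move=> w /= H N _; apply: contrapT => nb; apply: H; exists N => n t Nn nt.
apply: small_swing nt _ => bn; apply: nb; by exists n.
Qed.

(** * Divergent case: large increments that recur *)

Let quietP N s (y q : nat -> R) K M : {homo N : i j / (i <= j)%N} ->
  `|s| = 1 -> (forall k, (K <= k < K + M)%N -> 0 <= q k /\ (0 < q k ->
    let V' := V (N k.+1)%:R - V (N k)%:R in
    exists2 l, 0 < l & y k < l * V' / 2 - l^-1 /\ q k < expR (- (l ^+ 2 * V')) / 4)) ->
  (P (quiet I N s y K M) <= (\prod_(K <= k < K + M) (1 - q k))%:E)%E.
Proof.
move=> Nmono s1 Hq.
apply: (quiet_probability hF hB hBF hsigma hI Nmono s1) => k kKM.
have [q0 H] := Hq k kKM; split; first exact: q0.
by rewrite !grid0; exact: H.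
Qed.

Lemma prod_le_expR (q : nat -> R) K M : (forall k, 0 <= q k <= 1) ->
  \prod_(K <= k < K + M) (1 - q k) <= expR (- \sum_(K <= k < K + M) q k).
Proof.
move=> q01; rewrite -sumrN expR_sum; apply: ler_prod => k _.
by have /andP[? ?] := q01 k; rewrite subr_ge0; apply/andP; split => //; exact: expR_ge1Dx.
Qed.

(** Lower bound for the chance that [I] rises by more than a/5 over [n, n + 1], given quiet earlier
    intervals. The minimum reflects the two choices of [l] in [hit_parameters]; 8 instead of the 4
    of [conditional_lower_tail] leaves strict slack. *)
Definition hit_weight (a : R) n : R := if theta sigma n == 0 then 0 else
  Num.min (expR (- (a ^+ 2 / theta sigma n ^+ 2))) (expR (- 4)) / 8.

Lemma hit_weight_ge0 a n : 0 <= hit_weight a n.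
Proof.
by rewrite /hit_weight; case: ifP => // _; rewrite divr_ge0// le_min !expR_ge0.
Qed.

Lemma expRN_le1 (x : R) : 0 <= x -> expR (- x) <= 1.
Proof. by move=> x0; rewrite expR_le1 oppr_le0. Qed.

Lemma hit_weight_le1 a n : hit_weight a n <= 1.
Proof.
rewrite /hit_weight; case: ifP => // _; rewrite ler_pdivrMr// mul1r.
rewrite ge_min; apply/orP; right.
by apply: (@le_trans _ _ 1); [exact: expRN_le1|rewrite ler1n].
Qed.

(** For theta <= a/2, l = a/theta^2 gives l V'/2 - 1/l = a/2 - theta^2/a >= a/4; for larger theta, l
    = 2/theta gives theta/2 > a/4. The values of l^2 V' are a^2/theta^2 and 4. *)
Lemma hit_parameters a n : 0 < a -> 0 < hit_weight a n ->
  let V' := V n.+1%:R - V n%:R in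
  exists2 l, 0 < l & a / 5 < l * V' / 2 - l^-1 /\ hit_weight a n < expR (- (l ^+ 2 * V')) / 4.
Proof.
move=> a0; rewrite /hit_weight -thetaE; have [->|th] := eqVneq; first by rewrite ltxx.
have {}th : 0 < theta sigma n by rewrite lt_neqAle eq_sym th theta_ge0.
set t := theta sigma n in th * => _ /=.
have m0 : 0 < Num.min (expR (- (a ^+ 2 / t ^+ 2))) (expR (- 4)) by rewrite lt_min !expR_gt0.
have m8 x : Num.min (expR (- (a ^+ 2 / t ^+ 2))) (expR (- 4)) <= x ->
    Num.min (expR (- (a ^+ 2 / t ^+ 2))) (expR (- 4)) / 8 < x / 4 by lra.
have [ta|ta] := leP t (a / 2).
  exists (a / t ^+ 2); first by rewrite divr_gt0// exprn_gt0.
  split; last first.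
    have -> : (a / t ^+ 2) ^+ 2 * t ^+ 2 = a ^+ 2 / t ^+ 2 by field; rewrite gt_eqF.
    by apply: m8; rewrite ge_min lexx.
  have -> : a / t ^+ 2 * t ^+ 2 / 2 - (a / t ^+ 2)^-1 = a / 2 - t * t / a.
    by field; rewrite !gt_eqF.
  have : t * t / a <= a / 4.
    rewrite ler_pdivrMr// (@le_trans _ _ (a / 2 * (a / 2)))//; last lra.
    by rewrite ler_pM// ltW.
  lra.
exists (2 / t); first by rewrite divr_gt0.
split; last first.
  have -> : (2 / t) ^+ 2 * t ^+ 2 = 4 by field; rewrite gt_eqF.
  by apply: m8; rewrite ge_min lexx orbT.
have -> : 2 / t * t ^+ 2 / 2 - (2 / t)^-1 = t / 2 by field; rewrite gt_eqF.
lra.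
Qed.

Lemma nneseries_bounded (u : nat -> R) (C : R) : (forall n, 0 <= u n) ->
  (forall n, \sum_(0 <= i < n) u i <= C) -> (\sum_(0 <= i <oo) (u i)%:E < +oo)%E.
Proof.
move=> u0 uC; apply: le_lt_trans (ltry C); apply: lime_le.
  by apply: is_cvg_nneseries => n _ _; rewrite lee_fin.
by apply: nearW => n; rewrite sumEFin lee_fin.
Qed.

(** Were the partial sums bounded, the weights would tend to 0, so eventually exp(-a^2/theta^2) <
    exp(-4) and theta <= a/2. The summand of [Sprime] is then at most (a/2) exp(-a^2/theta^2), that
    is 4a times the weight, and [Sprime] would converge. *)
Lemma hit_weight_diverges (a eps : R) : 0 < a -> a ^+ 2 <= eps ^+ 2 / 2 ->
  Sprime sigma eps = +oo%E -> forall C, exists n, C < \sum_(0 <= i < n) hit_weight a i.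
Proof.
move=> a0 ae S'oo C; apply: contrapT => H.
have HC n : \sum_(0 <= i < n) hit_weight a i <= C.
  by rewrite leNgt; apply/negP => Cn; apply: H; exists n.
pose u n := if theta sigma n == 0 then 0 else
  theta sigma n * expR (- (eps ^+ 2 / 2 * (theta sigma n ^+ 2)^-1)).
have u0 n : 0 <= u n by rewrite /u; case: ifP => // _; rewrite mulr_ge0 ?theta_ge0// expR_ge0.
have cv0 : hit_weight a @ \oo --> 0.
  apply: cvg_series_cvg_0; apply: nondecreasing_is_cvgn.
    by apply: nondecreasing_series => n _ _; exact: hit_weight_ge0.
  by exists C => _ [n _ <-]; exact: HC.
have [K HK] : exists K, forall n, (K <= n)%N -> u n <= 4 * a * hit_weight a n.
  have e0 : 0 < expR (- 4) / 8 :> R by rewrite divr_gt0// expR_gt0.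
  have := cv0 => /cvgrPdist_lt/(_ _ e0)[K _ HK]; exists K => n /HK.
  rewrite /u sub0r normrN ger0_norm ?hit_weight_ge0// /hit_weight.
  have [th|th] := eqVneq; first by rewrite mulr0.
  have {}th : 0 < theta sigma n by rewrite lt_neqAle eq_sym th theta_ge0.
  set t := theta sigma n in th *.
  have t2 : 0 < t ^+ 2 by rewrite exprn_gt0.
  rewrite ltr_pM2r ?invr_gt0// gt_min ltxx orbF ltr_expR ltrN2 ltr_pdivlMr// => h.
  have ta : t <= a / 2.
    rewrite leNgt; apply/negP => ta.
    have : a / 2 * (a / 2) <= t * t by rewrite ler_pM// ?divr_ge0// ltW.
    rewrite expr2 in h; lra.
  have min_e : expR (- (a ^+ 2 / t ^+ 2)) <= expR (- 4).
    by rewrite ler_expR lerN2 ler_pdivlMr// ltW.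
  rewrite (min_idPl min_e).
  have -> : 4 * a * (expR (- (a ^+ 2 / t ^+ 2)) / 8) = a / 2 * expR (- (a ^+ 2 / t ^+ 2)) by field.
  apply: ler_pM => //; first exact: ltW.
  by rewrite ler_expR lerN2 ler_pM2r ?invr_gt0.
suff : (Sprime sigma eps < +oo)%E by rewrite S'oo ltxx.
apply: (@nneseries_bounded u (\sum_(0 <= i < K) u i + 4 * a * C)) => // n.
have a4 : 0 <= 4 * a by rewrite mulr_ge0// ltW.
have C0 : 0 <= C by have := HC 0%N; rewrite big_geq.
have [nK|Kn] := leqP n K.
  rewrite (@big_cat_nat _ _ _ n 0 K)//= -addrA lerDl.
  by apply: addr_ge0; [exact: sumr_ge0|exact: mulr_ge0].
rewrite (@big_cat_nat _ _ _ K 0 n) ?(ltnW Kn)//= lerD2l.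
apply: (@le_trans _ _ (\sum_(K <= i < n) 4 * a * hit_weight a i)).
  by rewrite big_nat_cond [leRHS]big_nat_cond; apply: ler_sum => k /andP[/andP[/HK]].
rewrite -mulr_sumr; apply: ler_wpM2l => //.
apply: le_trans (HC n); rewrite [leRHS](@big_cat_nat _ _ _ K 0 n) ?(ltnW Kn)//= lerDr.
by apply: sumr_ge0 => k _; exact: hit_weight_ge0.
Qed.

Lemma null_set_eps (A : set T) : (forall e : R, 0 < e -> (P A <= e%:E)%E) -> P A = 0%E.
Proof.
move=> Ae; apply/eqP; rewrite eq_le measure_ge0 andbT.
by apply/lee_addgt0Pr => e e0; rewrite add0e; exact: Ae.
Qed.

(* The increments are never shown to be independent: the product bound
   [quiet_probability] replaces independence in the divergent half of
   Borel--Cantelli. *)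
Lemma increments_infinitely_often (a eps : R) : 0 < a -> a ^+ 2 <= eps ^+ 2 / 2 ->
  Sprime sigma eps = +oo%E ->
  {ae P, forall w, forall K : nat, exists2 n, (K <= n)%N & a / 5 < I n.+1%:R w - I n%:R w}.
Proof.
move=> a0 ae S'oo.
pose A K := \bigcap_M quiet I id 1 (fun=> a / 5) K M.
have mA K : measurable (A K).
  by apply: bigcapT_measurable => M; exact: (measurable_quiet hF hI).
have A0 K : P (A K) = 0%E.
  have AM M : (P (A K) <= (expR (- \sum_(K <= k < K + M) hit_weight a k))%:E)%E.
    apply: (@le_trans _ _ (P (quiet I id 1 (fun=> a / 5) K M))).
      apply: le_measure; rewrite ?inE//; first exact: (measurable_quiet hF hI).
      by move=> w; apply.
    apply: (@le_trans _ _ (\prod_(K <= k < K + M) (1 - hit_weight a k))%:E).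
      apply: quietP; rewrite ?normr1// => k _; split; first exact: hit_weight_ge0.
      exact: hit_parameters.
    rewrite lee_fin; apply: prod_le_expR => k.
    by rewrite hit_weight_ge0 hit_weight_le1.
  (* The weights from [K] on are summed beyond [e^-1], because [expR (- e^-1) <= e]. *)
  apply: null_set_eps => e e0; have [n Hn] := hit_weight_diverges a0 ae S'oo
    (\sum_(0 <= k < K) hit_weight a k + e^-1).
  have Kn : (K <= n)%N.
    rewrite leqNgt; apply/negP => nK; move: Hn; rewrite ltNge => /negP; apply.
    rewrite (@big_cat_nat _ _ _ n 0 K) ?(ltnW nK)//= -addrA lerDl addr_ge0 ?invr_ge0 ?(ltW e0)//.
    by apply: sumr_ge0 => k _; exact: hit_weight_ge0.
  apply: le_trans (AM (n - K)%N) _; rewrite subnKC// lee_fin.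
  move: Hn; rewrite (@big_cat_nat _ _ _ K 0 n)//= ltrD2l => Hn.
  rewrite expRN invf_ple ?posrE ?expR_gt0//.
  by apply: le_trans (expR_ge1Dx _); rewrite (le_trans (ltW Hn))// lerDr.
apply: ae_foralln => K; exists (A K); split; [exact: mA|exact: A0|] => w /= H M _ k /andP[Kk _].
rewrite mul1r !grid0 leNgt; apply/negP => h; apply: H.
by exists k.
Qed.

(** * The integral does not follow a line of positive slope *)

Lemma expRN_le_inv (z : R) : 0 < z -> expR (- z) <= z^-1.
Proof.
move=> z0; rewrite expRN lef_pV2 ?posrE ?expR_gt0//.
by apply: le_trans (expR_ge1Dx _); rewrite lerDr.
Qed.

Definition above_line (s r C : R) (N : nat) : set T :=
  [set w | forall n : nat, (N <= n)%N -> r * n%:R - C <= s * (I n%:R w - I 0 w)].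

Lemma measurable_above_line s r C N : measurable (above_line s r C N).
Proof.
have -> : above_line s r C N = \bigcap_(n in [set n | (N <= n)%N])
    (~` [set w | - (r * n%:R - C) < (- s) * (I (grid R 0 n) w - I (grid R 0 0) w)]).
  apply/seteqP; split => w H n Nn; have := H n Nn; rewrite /= !grid0 mulNr ltrN2.
    by rewrite leNgt => /negP.
  by move=> /negP; rewrite -leNgt.
apply: bigcap_measurableType => n _; apply: measurableC.
exact/measurable_superlevel/(measurable_I_increment hF hI).
Qed.

(** As the variance stays below u, a rise by X has probability at most exp(-X^2/(8u)) whatever the
    horizon, and staying above the line forces such a rise for every X. With X = 8u/e + 1 one has
    X^2 >= 8u/e, so the bound is at most e. *)
Lemma above_line_bounded s r C N (W : R) : `|s| = 1 -> 0 < r ->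
  (forall n : nat, V n%:R <= W) -> P (above_line s r C N) = 0%E.
Proof.
move=> s1 r0 VW; apply: null_set_eps => e e0.
pose u := W - V 0 + 1.
have u1 : 1 <= u by rewrite lerDr subr_ge0 -[0](mulr0n 1) VW.
have u0 : 0 < u by exact: lt_le_trans u1.
pose X := 8 * u / e + 1.
have ue : 0 < 8 * u / e by rewrite divr_gt0// mulr_gt0.
pose n := maxn N (Num.truncn ((X + `|C| + 1) / r)).+1.
have dn : X + `|C| + 1 <= r * n%:R.
  rewrite mulrC -ler_pdivrMr//; apply: le_trans (ltW (truncnS_gt _)) _.
  by rewrite ler_nat leq_maxr.
have X0 : 0 < X by rewrite addr_gt0.
apply: (@le_trans _ _ (P (excursion I 0 0 n s X))).
  apply: le_measure; rewrite ?inE//; first exact: measurable_above_line.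
  move=> w /(_ n (leq_maxl _ _)) h; exists n => //.
  rewrite add0n !grid0 -[0%:R]/0; apply: lt_le_trans h.
  by have := ler_norm C; lra.
apply: le_trans (tail (u := u) s1 X0 _) _.
  by rewrite add0n !grid0 (le_lt_trans (lerB (VW n) (lexx _)))// ltrDl.
rewrite lee_fin.
have z0 : 0 < X ^+ 2 / (8 * u) by rewrite divr_gt0 ?exprn_gt0 ?mulr_gt0.
apply: le_trans (expRN_le_inv z0) _.
rewrite invf_ple ?posrE// ler_pdivlMr ?mulr_gt0//.
have : 8 * u / e <= X * X.
  apply: (@le_trans _ _ (X * 1)); first by rewrite mulr1 lerDl.
  by rewrite ler_pM2l// lerDr ltW.
by rewrite mulrC expr2.
Qed.

(* Along a sparse sequence of times [Ns j] the next increment of the integral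
   dwarfs, with probability bounded below, everything accumulated before. *)
Lemma above_line_unbounded s r (k N : nat) : `|s| = 1 -> 0 <= r ->
  (forall W : R, exists n : nat, W < V n%:R) -> P (above_line s r k%:R N) = 0%E.
Proof.
move=> s1 r0 VW.
pose u (n : nat) := V n%:R - V 0 + 1.
have u1 n : 1 <= u n by rewrite lerDr subr_ge0 -[0](mulr0n 1) (quadvar_le hsigma)// ler_nat.
(* Up to time n the signed integral is unlikely to exceed 8 u 2^j; a next increment below -(k + 8 u
   2^j) then brings it under -k, hence under the line, as r >= 0. *)
pose y j n := k%:R + 8 * u n * 2 ^+ j.
have yk j n : 0 < 8 * u n * 2 ^+ j.
  by rewrite !mulr_gt0 ?exprn_gt0// (lt_le_trans _ (u1 n)).
have y0 j n : 0 < y j n by rewrite ltr_wpDl.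
have next (p : nat * nat) : exists n', (p.2 < n')%N /\
    4 * y p.1 p.2 ^+ 2 < V n'%:R - V p.2%:R.
  have [n' Hn'] := VW (V p.2%:R + 4 * y p.1 p.2 ^+ 2).
  exists n'; split; last by rewrite ltrBrDl.
  rewrite ltnNge; apply/negP => nn.
  have : V n'%:R <= V p.2%:R by rewrite (quadvar_le hsigma)// ler_nat.
  have : 0 <= y p.1 p.2 ^+ 2 by exact: sqr_ge0.
  lra.
have [g Hg] := choice next.
pose Ns := fix Ns j := if j is j'.+1 then g (j', Ns j') else 0%N.
have NsS j : (Ns j < Ns j.+1)%N /\ 4 * y j (Ns j) ^+ 2 < V (Ns j.+1)%:R - V (Ns j)%:R.
  exact: (Hg (j, Ns j)).
have Nsmono : {homo Ns : i j / (i <= j)%N}.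
  by apply: homo_leq; [exact: leqnn|exact: leq_trans|move=> j; apply: ltnW; have [] := NsS j].
have Nsge j : (j <= Ns j)%N.
  by elim: j => // j IH; apply: leq_ltn_trans IH _; have [] := NsS j.
(* If D > 4 y^2 is the variance of the next increment, l = 2/sqrt(D) gives l D/2 - 1/l = sqrt(D)/2 >
   y and l^2 D = 4, hence a probability bounded below independently of j. *)
pose q : R := expR (- 4) / 8.
have q0 : 0 < q by rewrite divr_gt0// expR_gt0.
apply: null_set_eps => e e0.
(* [M] blocks make (1 - q)^M at most e/2; [K] is then so large that the [M] excursion events, of
   probability at most [mesh R K] each, add at most e/2. *)
pose M := (Num.truncn (2 / (q * e))).+1.
have qe : 0 < q * e by rewrite mulr_gt0.
have Mq : 2 / e <= M%:R * q.
  have := ltW (truncnS_gt (2 / (q * e))); rewrite ler_pdivrMr// mulrA => h.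
  by rewrite ler_pdivrMr.
have M0 : 0 < M%:R :> R by rewrite ltr0n.
have eM : 0 < e / 2 / M%:R by rewrite !divr_gt0.
have [K0 HK0] := mesh_cvg eM.
pose K := maxn N K0.
have KM : M%:R * mesh R K <= e / 2.
  by rewrite mulrC -ler_pdivlMr// ltW// HK0// leq_maxr.
pose Q := quiet I Ns (- s) (fun j => y j (Ns j)) K M.
have PQ : (P Q <= (e / 2)%:E)%E.
  apply: (@le_trans _ _ (\prod_(K <= j < K + M) (1 - q))%:E).
    apply: quietP => //; first by rewrite normrN.
    move=> j _; split; first exact: ltW.
    move=> _; have [_ Vj] := NsS j; set D := V _ - V _ in Vj *.
    have D0 : 0 < D by apply: le_lt_trans Vj; rewrite mulr_ge0// sqr_ge0.
    have sD : 0 < Num.sqrt D by rewrite sqrtr_gt0.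
    have DD : D = Num.sqrt D ^+ 2 by rewrite sqr_sqrtr// ltW.
    exists (2 / Num.sqrt D); first exact: divr_gt0.
    split; last first.
      rewrite {2}DD; have -> : (2 / Num.sqrt D) ^+ 2 * Num.sqrt D ^+ 2 = 4.
        by field; rewrite gt_eqF.
      by rewrite /q; have := expR_gt0 (- 4 : R); lra.
    rewrite {2}DD.
    have -> : 2 / Num.sqrt D * Num.sqrt D ^+ 2 / 2 - (2 / Num.sqrt D)^-1 = Num.sqrt D / 2.
      by field; rewrite gt_eqF.
    rewrite ltr_pdivlMr// -(ltr_pXn2r (n := 2))// ?nnegrE ?mulr_ge0 ?(ltW sD) ?(ltW (y0 _ _))//.
    rewrite -DD exprMn; lra.
  rewrite lee_fin; apply: le_trans (@prod_le_expR (fun=> q) K M _) _.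
    move=> _; rewrite (ltW q0)/= /q ler_pdivrMr// mul1r.
    by apply: (@le_trans _ _ 1); [exact: expRN_le1|rewrite ler1n].
  rewrite big_const_nat addKn iter_addr_0 -[q *+ M]mulr_natl.
  have Mq0 : 0 < M%:R * q by rewrite mulr_gt0.
  apply: le_trans (expRN_le_inv Mq0) _.
  by rewrite invf_ple ?posrE ?divr_gt0// invf_div.
apply: (@le_trans _ _ (P Q + (M%:R * mesh R K)%:E)%E); last first.
  have -> : e = e / 2 + e / 2 by field.
  by rewrite EFinD; apply: leeD => //; rewrite lee_fin.
apply: (union_bound (D := fun j => excursion I 0 0 (Ns (K + j)%N) s
  (8 * u (Ns (K + j)%N) * 2 ^+ (K + j)))) => //.
- exact: measurable_above_line.
- exact: (measurable_quiet hF hI).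
- move=> w Aw; apply: contrapT => H.
  have nE j : (j < M)%N -> s * (I (Ns (K + j)%N)%:R w - I 0 w) <= 8 * u (Ns (K + j)%N) * 2 ^+ (K + j).
    move=> jM; rewrite leNgt; apply/negP => h; apply: H; right; exists j => //.
    by exists (Ns (K + j)%N) => //; rewrite add0n !grid0.
  apply: H; left => j /andP[Kj jKM]; rewrite !grid0 leNgt; apply/negP => h.
  have := nE (j - K)%N; rewrite ltn_subLR// jKM subnKC// => /(_ isT) h'.
  have := Aw (Ns j.+1); rewrite (leq_trans _ (Nsge _))//; last first.
    by rewrite ltnW// ltnS (leq_trans _ Kj)// leq_maxl.
  move=> /(_ isT); have : 0 <= r * (Ns j.+1)%:R by rewrite mulr_ge0.
  rewrite /y in h; lra.
move=> j jM; set n := Ns _.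
apply: le_trans (tail (u := u n) s1 (yk _ _) _) _.
  by rewrite add0n !grid0 ltrDl.
rewrite lee_fin.
have z0 : 0 < (8 * u n * 2 ^+ (K + j)) ^+ 2 / (8 * u n).
  by rewrite divr_gt0 ?exprn_gt0// mulr_gt0// (lt_le_trans _ (u1 n)).
apply: le_trans (expRN_le_inv z0) _.
rewrite /mesh lef_pV2 ?posrE ?exprn_gt0//.
have un : 0 < u n by rewrite (lt_le_trans _ (u1 n)).
have -> : (8 * u n * 2 ^+ (K + j)) ^+ 2 / (8 * u n) = 8 * u n * 2 ^+ (K + j) * 2 ^+ (K + j).
  by field; rewrite gt_eqF.
have p2 : (1 : R) <= 2 ^+ (K + j) by rewrite exprn_ege1// ler1n.
apply: (@le_trans _ _ (2 ^+ (K + j))); first by rewrite ler_weXn2l ?ler1n ?leq_addr.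
rewrite ler_peMl ?exprn_ge0//.
by apply: mulr_ege1 => //; apply: mulr_ege1 => //; rewrite ler1n.
Qed.

(** The lines with slope 1/(k + 1) and offset k form a countable family that reaches below any given
    line of positive slope, so one null set serves all r and C. *)
Lemma drift_beats_integral (s : R) : `|s| = 1 ->
  {ae P, forall w, forall r C T0 : R, 0 < r -> exists2 t, T0 <= t & s * I t w < r * t - C}.
Proof.
move=> s1.
have A0 k N : P (above_line s (k.+1%:R)^-1 k%:R N) = 0%E.
  have [[W VW]|unb] := pselect (exists W : R, forall n : nat, V n%:R <= W).
    by apply: above_line_bounded VW.
  apply: above_line_unbounded => //.
  move=> W; apply: contrapT => H; apply: unb; exists W => n.
  by rewrite leNgt; apply/negP => Wn; apply: H; exists n.
have : {ae P, forall w, forall k N, ~ above_line s (k.+1%:R)^-1 k%:R N w}.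
  apply: ae_foralln => k; apply: ae_foralln => N.
  exists (above_line s (k.+1%:R)^-1 k%:R N); split; [exact: measurable_above_line|exact: A0|].
  by move=> w /= /contrapT.
apply: filterS => w H r C T0 r0.
(* [above_line] measures from [I 0 w], so this value is absorbed into the offset together with C. *)
pose k := maxn (Num.truncn r^-1).+1 (Num.truncn `|C + s * I 0 w|).+1.
pose N := (Num.truncn `|T0|).+1.
have := H k N; rewrite /above_line/= => /existsNP[n /not_implyP[Nn /negP]].
rewrite -ltNge => h; exists n%:R.
  apply: le_trans (ler_norm _) _; apply: le_trans (ltW (truncnS_gt _)) _.
  by rewrite ler_nat.
have kr : (k.+1%:R)^-1 <= r.
  rewrite invf_ple ?posrE//; apply: le_trans (ltW (truncnS_gt _)) _.
  by rewrite ler_nat (leq_trans (leq_maxl _ (Num.truncn `|C + s * I 0 w|).+1)).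
have kC : C + s * I 0 w <= k%:R.
  apply: le_trans (ler_norm _) _; apply: le_trans (ltW (truncnS_gt _)) _.
  by rewrite ler_nat leq_maxr.
have kn : (k.+1%:R)^-1 * n%:R <= r * n%:R by rewrite ler_wpM2r.
move: h kC kn; rewrite mulrBr.
move: (s * I n%:R w) (s * I 0 w) (_ * n%:R) (r * n%:R) (k%:R : R) => a b c e K.
lra.
Qed.

End almost_sure_increments.

(** * Asymptotics of the solution *)

Section limsup_transfer.
Context (R : realType) (f : R -> R) (xi : R) (i x y : R -> R).
Local Notation mu := lebesgue_measure.
Local Notation limsup u := (limf_esup (fun t => `|u t|%:E) +oo%R).
Hypotheses (cf : continuous f) (f_pos : forall z, z != 0 -> 0 < z * f z).
Hypotheses (f_coercive : coercive f) (flip_coercive : coercive (flip f)).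
Hypotheses (ci : half_cont i) (cx : half_cont x) (cy : half_cont y).
Hypothesis x_eq : forall t, 0 <= t ->
  x t = xi - \int[mu]_(s in `[0, t]) f (x s) + i t.
Hypothesis y_eq : forall t, 0 <= t ->
  y t = 0 - \int[mu]_(s in `[0, t]) y s + i t.

Lemma limsup_le_xupper (b : R) : 0 < b -> (limsup y <= b%:E)%E ->
  (limsup x <= (xupper f b)%:E)%E.
Proof.
move=> b0 yb; rewrite /xupper fminusE opprK; apply: limsup_abs_path_le.
have fa z : fplus f b < z -> b < f z by exact: fplus_gt.
have fa' z : fplus (flip f) b < z -> b < flip f z.
  by apply: fplus_gt => //; exact: flip_continuous.
apply: (solution_upper cf f_coercive flip_coercive cx cy x_eq y_eq fa fa') => n n0.
by apply: limsup_abs_path_lt; rewrite (le_lt_trans yb)// lte_fin ltrDl.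
Qed.

Lemma limsup_le_lower (l M : R) : limsup x = l%:E ->
  (forall z, `|z| <= l -> `|f z| <= M) -> (limsup y <= (2 * l + M)%:E)%E.
Proof.
move=> xl fM; apply: limsup_abs_path_le.
apply: (solution_lower cf cx cy x_eq y_eq _ fM).
  by rewrite -lee_fin -xl limsup_abs_path_ge0.
exact: limsup_abs_path_eq.
Qed.

Lemma xlower_le_limsup (b l : R) : limsup x = l%:E -> (b%:E <= limsup y)%E ->
  xlower f b <= l.
Proof.
move=> xl bly; have l0 : 0 <= l by rewrite -lee_fin -xl limsup_abs_path_ge0.
(* Without a root [xget] returns 0 and the claim is l >= 0. With a root z > l, the supremum over
   [-z, z] bounds |f| on [-l, l], whence limsup |y| <= 2l + sup < 2z + sup = b. *)
rewrite /xlower; case: xgetP => [z _ [z0 zE]|_ //].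
rewrite leNgt; apply/negP => lz.
pose S r := [set `|f u| | u in `[- r, r]].
have supS r : 0 <= r -> has_sup (S r).
  move=> r0; split; first by exists `|f 0|, 0 => //; rewrite /= in_itv/= oppr_le0 r0.
  have [K HK] := continuous_bounded r cf; exists K => _ [u ur <-].
  by apply: HK; rewrite ler_norml; move: ur; rewrite /= in_itv.
have fS u : `|u| <= l -> `|f u| <= sup (S z).
  move=> ul; apply: ub_le_sup; first by case: (supS z z0).
  by exists u => //; rewrite /= in_itv/= -ler_norml (le_trans ul)// ltW.
have := le_trans bly (limsup_le_lower xl fS).
by rewrite lee_fin -zE -/(S z); lra.
Qed.

(** The degenerate case b = a = a' = 0 of [solution_upper]. *)
Lemma solution_vanishes :
  (forall e, 0 < e -> exists T, forall t, T <= t -> `|y t| <= e) ->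
  x t @[t --> +oo] --> 0.
Proof.
move=> y0.
have fa z : 0 < z -> 0 < f z by move=> z0; rewrite -(pmulr_rgt0 _ z0) f_pos ?gt_eqF.
have fa' z : 0 < z -> 0 < flip f z.
  by move=> z0; rewrite /flip -(pmulr_rgt0 _ z0) mulrN -mulNr f_pos// oppr_eq0 gt_eqF.
have y0' n : 0 < n -> exists T, forall t, T <= t -> `|y t| <= 0 + n.
  by rewrite add0r; exact: y0.
apply/cvgrPdist_le => e e0.
have [M HM] := solution_upper cf f_coercive flip_coercive cx cy x_eq y_eq fa fa' y0' e0.
exists M; split=> [|t Mt]; first exact: num_real.
rewrite sub0r normrN.
by have := HM t (ltW Mt); rewrite maxxx mulr0 !add0r.
Qed.

(** [y] solves the equation with f = id, so if |y| <= c/4 eventually, the unit increments of [i] are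
    at most 2c/4 + c/4 < c. *)
Lemma limsup_ou_gt0 (c : R) : 0 < c ->
  (forall K : nat, exists2 n, (K <= n)%N & c < i n.+1%:R - i n%:R) ->
  (0 < limsup y)%E.
Proof.
move=> c0 Hi; rewrite lt_neqAle limsup_abs_path_ge0 andbT eq_sym.
apply/eqP => yl0; have c4 : 0 < c / 4 by rewrite divr_gt0.
have [M HM] := limsup_abs_path_eq yl0 c4.
have [n Mn cn] := Hi (Num.truncn M).+1.
have nM : M <= n%:R.
  by rewrite (le_trans (ltW (truncnS_gt _)))// ler_nat.
have idb (z : R) : `|z| <= 0 + c / 4 -> `|id z| <= 0 + c / 4 by [].
have nn : n%:R <= n.+1%:R :> R by rewrite ler_nat.
have := solution_increment (fun z => @cvg_id _ (nbhs z)) cy y_eq idb HM (ler0n _ n) nM nn.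
move=> /(le_trans (ler_norm _)); rewrite -natrB// subSnn; lra.
Qed.

Lemma limsup_pinfty :
  (forall k K : nat, exists2 n, (K <= n)%N & k%:R < i n.+1%:R - i n%:R) ->
  limsup x = +oo%E.
Proof.
move=> Hi; apply: limsup_abs_path_pinfty => K M; apply: contrapT => H.
have xK t : M <= t -> `|x t| <= K.
  by move=> Mt; rewrite leNgt; apply/negP => Kx; apply: H; exists t.
have [L HL] := continuous_bounded K cf.
have [n Mn kn] := Hi (Num.truncn (2 * K + L)).+1 (Num.truncn M).+1.
have nM : M <= n%:R.
  by rewrite (le_trans (ltW (truncnS_gt _)))// ler_nat.
have nn : n%:R <= n.+1%:R :> R by rewrite ler_nat.
have := solution_increment cf cx x_eq HL xK (ler0n _ n) nM nn.
move=> /(le_trans (ler_norm _)); rewrite -natrB// subSnn mulr1.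
have := truncnS_gt (2 * K + L); lra.
Qed.

End limsup_transfer.

(** Provides one constant c, the same for all outcomes, below which limsup |X| cannot lie; this
    makes the infimum positive without showing that the equation defining [xlower] has a root. *)
Lemma limsup_uniform_lower_bound (R : realType) (f : R -> R) (b : R) :
  continuous f -> f 0 = 0 -> 0 < b ->
  exists2 c, 0 < c & forall l, l < c ->
    exists2 M, (forall z, `|z| <= l -> `|f z| <= M) & 2 * l + M < b.
Proof.
move=> cf f0 b0; have b3 : 0 < b / 3 by rewrite divr_gt0.
have := cf 0 => /cvgrPdist_lt/(_ _ b3)/nbhs_ballP[n /= n0 Hn].
exists (Num.min n (b / 3)); first by rewrite lt_min n0.
move=> l; rewrite lt_min => /andP[ln lb]; exists (b / 3); last lra.
move=> z zl; have := Hn z; rewrite /ball/= sub0r normrN f0 sub0r normrN.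
by rewrite (le_lt_trans zl ln) => /(_ isT)/ltW.
Qed.

Lemma coercive_pinfty (R : realType) (f : R -> R) :
  f x @[x --> +oo] --> +oo -> coercive f.
Proof.
move=> /cvgryPge H A; have [M [_ HM]] := H A; exists (M + 1) => z Mz.
by apply: HM; rewrite (lt_le_trans _ Mz)// ltrDl.
Qed.

Lemma coercive_flip_ninfty (R : realType) (f : R -> R) :
  f x @[x --> -oo] --> -oo -> coercive (flip f).
Proof.
move=> /cvgrNyPle H A; have [M [_ HM]] := H (- A); exists (- M + 1) => z Mz.
by rewrite /flip lerNr; apply: HM; lra.
Qed.

Theorem theorem7 (d : measure_display) (T : measurableType d) (R : realType)
    (P : probability T R) (F : R -> set (set T)) (B : R -> T -> R)
    (sigma f : R -> R) (xi : R) (I X Y : R -> T -> R)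
    (hF : complete_filtration P F)
    (hB : brownian_motion P B) (hBF : adapted F B)
    (hsigma : {within `[0, +oo[%classic, continuous sigma})
    (hf : continuous f)
    (hxf : forall x, x != 0 -> 0 < x * f x) (hf0 : f 0 = 0)
    (hfN : f x @[x --> -oo] --> -oo) (hfP : f x @[x --> +oo] --> +oo)
    (hI : is_stochastic_integral P F sigma B I)
    (hX : is_solution P F f xi I X)
    (hY : is_solution P F id 0 I Y) :
  let Omega_X := solution_event f xi I X in
  let Omega_1 := omega1 I Y in
  let Ylow := inf_limsup Omega_1 Y in
  let Yup := sup_limsup Omega_1 Y in
  [/\ (* (A) *)
      (forall eps : R, 0 < eps -> (Sprime sigma eps < +oo)%E) ->
        {ae P, forall w, X t w @[t --> +oo] --> (0 : R)},
      (* (B); the bounds on Ylow and Yup are standing assumptions, since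
         pointwise extrema over an almost sure event depend on null sets *)
      (exists eps' : R,
         [/\ 0 < eps',
             (forall eps : R, eps' < eps -> (Sprime sigma eps < +oo)%E) &
             (forall eps : R, 0 < eps -> eps < eps' ->
                Sprime sigma eps = +oo%E)]) ->
        (exists Omega_2 : set T,
           [/\ Omega_2 = Omega_1 `&` Omega_X,
               almost_sure_event P Omega_2 &
               (0 < Ylow)%E -> (Yup < +oo)%E ->
               exists Xlow Xup : R,
                 [/\ 0 < Xlow /\ Xlow <= Xup,
                     Xlow%:E = inf_limsup Omega_2 X,
                     Xup%:E = sup_limsup Omega_2 X,
                     xlower f (fine Ylow) <= Xlow &
                     Xup <= xupper f (fine Yup)]]) /\
        {ae P, forall w, liminf_abs X w = 0%E}
    & (* (C) *)
      (forall eps : R, 0 < eps -> Sprime sigma eps = +oo%E) ->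
        {ae P, forall w, limsup_abs X w = +oo%E /\ liminf_abs X w = 0%E}].
Proof.
move=> Omega_X Omega_1 Ylow Yup.
have fC := coercive_pinfty hfP; have fC' := coercive_flip_ninfty hfN.
have ci w : half_cont (fun t => I t w) by exact: (I_cont hI).
have cx w : half_cont (fun t => X t w) by case: hX => _ + _; apply.
have cy w : half_cont (fun t => Y t w) by case: hY => _ + _; apply.
have aeX : {ae P, forall w, Omega_X w} by case: hX.
have aeY : {ae P, forall w, solution_event id 0 I Y w} by case: hY.
have liminf0 : {ae P, forall w, liminf_abs X w = 0%E}.
  have aeP := drift_beats_integral hF hB hBF hsigma hI (normr1 R).
  have aeN := drift_beats_integral hF hB hBF hsigma hI (etrans (normrN 1) (normr1 R)).
  apply: filterS3 aeX aeP aeN => w Xw HP HN; apply: liminf_abs_path_eq0 => e t0 e0.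
  apply: (solution_liminf hf hxf fC fC' (cx w) Xw) => //.
    by move=> r C t1 r0; have [t tt1 It] := HP r C t1 r0; exists t; rewrite -1?[I t w]mul1r.
  by move=> r C t1 r0; have [t tt1 It] := HN r C t1 r0; exists t; rewrite -1?mulN1r.
split.
- move=> S'A.
  have small : {ae P, forall w, forall k, exists N : nat, forall (n : nat) t, (N <= n)%N ->
      n%:R <= t <= n.+1%:R -> `|I t w - I n%:R w| <= k.+1%:R^-1}.
    apply: ae_foralln => k; have k0 : 0 < k.+1%:R^-1 :> R by rewrite invr_gt0.
    (* The choice eps = x/4 satisfies eps^2/2 = x^2/32 < x^2/16. *)
    have k4 : 0 < k.+1%:R^-1 / 4 :> R by rewrite divr_gt0.
    apply: (swing_eventually_small hF hB hBF hsigma hI k0 k4); last exact: S'A.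
    by have := exprn_gt0 2 k0; rewrite expr_div_n; set u := (_ ^-1 ^+ 2); lra.
  apply: filterS3 aeX aeY small => w Xw Yw Hk.
  apply: (solution_vanishes hf hxf fC fC' (cx w) (cy w) Xw Yw) => e e0.
  have k0 : 0 < (Num.truncn (5 / e)).+1%:R^-1 :> R by rewrite invr_gt0.
  have [N HN] := Hk (Num.truncn (5 / e)).
  have [M HM] := solution_ou (ci w) (cy w) Yw k0 HN.
  exists M => t Mt; rewrite (le_trans (HM t Mt))// ler_pdivrMr// mulrC -ler_pdivrMr//.
  exact/ltW/truncnS_gt.
- move=> [e' [e0 Sfin Sinf]]; split; last exact: liminf0.
  exists (Omega_1 `&` Omega_X).
  have aeO : {ae P, forall w, (Omega_1 `&` Omega_X) w}.
    (* Constants on the right side of [e']: 2e' with (2e')^2/2 < (8e')^2/16 bounds the swings, and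
       e'/2 with (e'/4)^2 <= (e'/2)^2/2 makes large increments recur. *)
    have e8 : 0 < 8 * e' by rewrite mulr_gt0.
    have e2 : 0 < 2 * e' by rewrite mulr_gt0.
    have e4 : 0 < e' / 4 by rewrite divr_gt0.
    have h2 : 0 < e' / 2 by rewrite divr_gt0.
    have ee := exprn_gt0 2 e0.
    have aeF := swing_eventually_small hF hB hBF hsigma hI e8 e2.
    have aeI := increments_infinitely_often hF hB hBF hsigma hI e4.
    apply: filterS3 (filterI aeX aeY) (aeF _ _) (aeI _ _ (Sinf _ h2 _)).
    + move=> w [Xw Yw] [N HN] Iw; split=> //; split=> //; split.
        by apply: (limsup_ou_gt0 (cy w) Yw _ Iw); rewrite divr_gt0.
      have [M HM] := solution_ou (ci w) (cy w) Yw e8 HN.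
      apply: le_lt_trans (ltry (5 * (8 * e'))); apply: limsup_abs_path_le => n n0.
      by exists M => t /HM/le_trans; apply; rewrite lerDl ltW.
    + by rewrite !exprMn; lra.
    + by apply: Sfin; lra.
    + by rewrite !expr_div_n; lra.
    + lra.
  (* Pathwise equations and limsups over real times give no measurability by themselves; the
     complement is negligible, and completeness of [P] does the rest. *)
  have mO : measurable (Omega_1 `&` Omega_X).
    by case: hF => Pc _ _ _ _; rewrite -[X in measurable X]setCK; apply: measurableC; exact: Pc.
  have PO : P (Omega_1 `&` Omega_X) = 1%E.
    rewrite -[X in P X]setCK (probability_setC P (measurableC mO)).
    by rewrite (measure_negligible (measurableC mO) aeO) sube0.
  split=> // Yl0 Yuoo.
  have [w0 Ow0] : Omega_1 `&` Omega_X !=set0.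
    by apply/set0P/negP => /eqP O0; move: PO; rewrite O0 measure0 => -[] /esym/eqP; rewrite oner_eq0.
  have Yle w : Omega_1 w -> (Ylow <= limsup_abs Y w)%E by move=> w1; apply: ereal_inf_lbound; exists w.
  have Yge w : Omega_1 w -> (limsup_abs Y w <= Yup)%E by move=> w1; apply: ereal_sup_ubound; exists w.
  have YlE : Ylow = (fine Ylow)%:E.
    rewrite fineK// gt0_fin_numE//; have [[_ [_ Yoo]] _] := Ow0.
    by apply: le_lt_trans Yoo; apply: Yle; case: Ow0.
  have Yu0 : (0 < Yup)%E.
    have [[_ [Y0 _]] _] := Ow0.
    by apply: lt_le_trans Y0 _; apply: Yge; case: Ow0.
  have YuE : Yup = (fine Yup)%:E by rewrite fineK// gt0_fin_numE.
  have upper w : (Omega_1 `&` Omega_X) w -> (limsup_abs X w <= (xupper f (fine Yup))%:E)%E.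
    move=> [w1 Xw]; have [Yw _] := w1.
    apply: (limsup_le_xupper hf fC fC' (cx w) (cy w) Xw Yw).
      by rewrite fine_gt0// Yu0.
    by rewrite -YuE; exact: Yge.
  have XE w : (Omega_1 `&` Omega_X) w -> limsup_abs X w = (fine (limsup_abs X w))%:E.
    move=> w2; rewrite fineK// ge0_fin_numE ?limsup_abs_path_ge0//.
    by rewrite (le_lt_trans (upper w w2))// ltry.
  have fYl0 : 0 < fine Ylow by rewrite -lte_fin -YlE.
  have [c c0 Hc] := limsup_uniform_lower_bound hf hf0 fYl0.
  have lower w : (Omega_1 `&` Omega_X) w -> (c%:E <= limsup_abs X w)%E.
    move=> w2; have [[Yw _] Xw] := w2; rewrite XE// lee_fin leNgt; apply/negP => /Hc[M HM Mb].
    have := limsup_le_lower hf (cx w) (cy w) Xw Yw (XE w w2) HM.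
    apply/negP; rewrite -ltNge (lt_le_trans _ (Yle w _))//; last by case: w2.
    by rewrite YlE lte_fin.
  have lower' w : (Omega_1 `&` Omega_X) w -> ((xlower f (fine Ylow))%:E <= limsup_abs X w)%E.
    move=> w2; have [[Yw _] Xw] := w2; rewrite XE// lee_fin.
    apply: (xlower_le_limsup hf (cx w) (cy w) Xw Yw (XE w w2)).
    by rewrite -YlE Yle//; case: w2.
  pose Xlow := inf_limsup (Omega_1 `&` Omega_X) X.
  pose Xup := sup_limsup (Omega_1 `&` Omega_X) X.
  have Xl u : (forall w, (Omega_1 `&` Omega_X) w -> (u <= limsup_abs X w)%E) -> (u <= Xlow)%E.
    by move=> H; apply: le_ereal_inf_tmp => _ [w w2 <-]; exact: H.
  have Xu : (Xup <= (xupper f (fine Yup))%:E)%E.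
    by apply: ge_ereal_sup => _ [w w2 <-]; exact: upper.
  have Xlu : (Xlow <= Xup)%E.
    apply: (@le_trans _ _ (limsup_abs X w0)).
      by apply: ereal_inf_lbound; exists w0.
    by apply: ereal_sup_ubound; exists w0.
  have Xl0 : (0 < Xlow)%E by rewrite (lt_le_trans _ (Xl _ lower))// lte_fin.
  have Xuoo : (Xup < +oo)%E by rewrite (le_lt_trans Xu)// ltry.
  have XlE : Xlow = (fine Xlow)%:E by rewrite fineK// gt0_fin_numE// (le_lt_trans Xlu).
  have XuE : Xup = (fine Xup)%:E by rewrite fineK// gt0_fin_numE// (lt_le_trans Xl0).
  exists (fine Xlow), (fine Xup); split=> //.
  + by rewrite -!lee_fin -lte_fin -XlE -XuE.
  + by rewrite -lee_fin -XlE; exact: Xl.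
  + by rewrite -lee_fin -XuE.
- move=> S'C.
  have large : {ae P, forall w, forall k K : nat,
      exists2 n, (K <= n)%N & k%:R < I n.+1%:R w - I n%:R w}.
    (* The level a = 5(k + 1) gives a/5 = k + 1 > k, and eps = 2a satisfies a^2 <= eps^2/2. *)
    apply: ae_foralln => k; have k0 : 0 < 5 * k.+1%:R :> R by rewrite mulr_gt0.
    have k2 : 0 < 2 * (5 * k.+1%:R) :> R by rewrite mulr_gt0.
    have := increments_infinitely_often hF hB hBF hsigma hI k0 _ (S'C _ k2).
    have kk : (5 * k.+1%:R) ^+ 2 <= (2 * (5 * k.+1%:R)) ^+ 2 / 2 :> R.
      by rewrite (exprMn 2 2); have := exprn_gt0 2 k0; lra.
    move=> /(_ kk); apply: filterS => w H K; have [n Kn Hn] := H K; exists n => //.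
    by apply: lt_trans Hn; rewrite mulrC mulKf// ltr_nat.
  apply: filterS3 aeX liminf0 large => w Xw Lw Hk; split=> //.
  exact: (limsup_pinfty hf (cx w) Xw Hk).
Qed.
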